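(* Let $\mathcal{A}$ be a unital finite-dimensional $C^*$-algebra, and let $\mathcal{E}$ be the energy form for a metrically connected Riemannian metric on $\mathcal{A}$ and a faithful trace $\tau$ on $\mathcal{A}$. Assume further that $\mathcal{E}$ is real. Let $\mathcal{B}=p\mathcal{A}$ be a quotient $C^*$-algebra of $\mathcal{A}$, where $p$ is a proper central projection of $\mathcal{A}$ ($0\neq p\neq 1_{\mathcal{A}}$), and let $\mathcal{E}^{\mathcal{B}}$ be the quotient form on $\mathcal{B}$. Then $\mathcal{E}^{\mathcal{B}}$ is the energy form for a metrically connected Riemannian metric on $\mathcal{B}$ (together with a faithful trace on $\mathcal{B}$).
   Context: Riemannian metric: a triple $(\Omega,\partial,\langle\cdot,\cdot\rangle_{\mathcal{A}})$ where $\Omega$ is a unital $\mathcal{A}$-bimodule; $\partial:\mathcal{A}\to\Omega$ is linear with $\partial(ab)=(\partial a)b+a\,\partial b$; the range of $\partial$ generates $\Omega$ as a bimodule; and $\langle\cdot,\cdot\rangle_{\mathcal{A}}:\Omega\times\Omega\to\mathcal{A}$ is sesquilinear (conjugate-linear in the first variable) with $\langle\omega,\omega'a\rangle_{\mathcal{A}}=\langle\omega,\omega'\rangle_{\mathcal{A}}a$, $(\langle\omega,\omega'\rangle_{\mathcal{A}})^*=\langle\omega',\omega\rangle_{\mathcal{A}}$, $\langle a\omega,\omega'\rangle_{\mathcal{A}}=\langle\omega,a^*\omega'\rangle_{\mathcal{A}}$, and $\langle\omega,\omega\rangle_{\mathcal{A}}\geq 0$ with equality only for $\omega=0$. Its CdC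 is $\Gamma(a,b)=\langle\partial a,\partial b\rangle_{\mathcal{A}}$. It is metrically connected if $\Gamma(a,a)=0$ only when $a\in\mathbb{C}1_{\mathcal{A}}$. A trace is a positive linear functional $\tau$ with $\tau(ab)=\tau(ba)$; $\langle a,b\rangle_\tau=\tau(a^*b)$, and $L^2(\mathcal{A},\tau)$ is $\mathcal{A}$ with this inner product when $\tau$ is faithful. The energy form for the metric and $\tau$ is $\mathcal{E}(a,b)=\tau(\Gamma(a,b))$. It is real if $\mathcal{E}(a^*,b^* )=\mathcal{E}(b,a)$ for all $a,b$. The Laplace operator $\Delta$ is the positive operator on $L^2(\mathcal{A},\tau)$ with $\mathcal{E}(a,b)=\langle a,\Delta b\rangle_\tau$. Quotient form: every quotient of $\mathcal{A}$ is of the form $\mathcal{B}=p\mathcal{A}$ with $p$ a central projection and quotient map $a\mapsto pa$. Put $\mathcal{C}=(1-p)\mathcal{A}$, so $L^2(\mathcal{A},\tau)=L^2(\mathcal{B},\tau)\oplus L^2(\mathcal{C},\tau)$ orthogonally (with $\tau$ restricted), and write $\Delta=\begin{pmatrix}R&J^*\\ J&S\end{pmatrix}$ for this decomposition. By metric connectedness $S$ is invertible. Set $\Delta^{\mathcal{B}}=R-J^*S^{-1}J$ and $\mathcal{E}^{\mathcal{B}}(b,b')=\langle b,\Delta^{\mathcal{B}}(b')\rangle_\tau$ for $b,b'\in\mathcal{B}$. (Equivalently, $\mathcal{E}^{\mathcal{B}}(b,b)^{1/2}$ is the quotient seminorm $\inf\{\mathcal{E}(a,a)^{1/2}: a\in\mathcal{A},\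 pa=b\}$.) *)

(* Defs.v *)
From HB Require Import structures.
From mathcomp Require Import all_boot all_order all_algebra all_field.
From mathcomp Require Import reals complex.

Set Implicit Arguments.
Unset Strict Implicit.
Unset Printing Implicit Defensive.

Import Order.TTheory GRing.Theory Num.Theory.

Local Open Scope ring_scope.

(* The complex field is R[i] for R : realType.  Finite dimensionality is part
   of falgType, so that the norm is automatically complete. *)
HB.mixin Record isCStar (R : realType) A of Falgebra R[i] A := {
  star : A -> A;
  cstar_norm : A -> R;
  starK : involutive star;
  starD : {morph star : x y / x + y};
  starZ : forall (c : R[i]) (x : A), star (c *: x) = c^* *: star x;
  starM : forall x y : A, star (x * y) = star y * star x;
  cstar_normD : forall x y : A,
    cstar_norm (x + y) <= cstar_norm x + cstar_norm y;
  cstar_normZ : forall (c : R[i]) (x : A),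
    cstar_norm (c *: x) = complex.Re `|c| * cstar_norm x;
  cstar_norm0_eq0 : forall x : A, cstar_norm x = 0 -> x = 0;
  cstar_normM : forall x y : A,
    cstar_norm (x * y) <= cstar_norm x * cstar_norm y;
  cstar_normE : forall x : A, cstar_norm (star x * x) = cstar_norm x ^+ 2
}.

#[short(type="cstarAlgType")]
HB.structure Definition CStarAlgebra (R : realType) :=
  { A of isCStar R A & Falgebra R[i] A }.

Section CStarTheory.
Variables (R : realType) (A : cstarAlgType R).

Definition cstar_nonneg (a : A) : Prop := exists b : A, a = star b * b.

(* The two scalar conditions say that the complex structures on Om coming
   from the left and right actions are the given one. *)
Record bimodule := Bimodule {
  bim_sort :> lmodType R[i];
  lact : A -> bim_sort -> bim_sort;
  ract : bim_sort -> A -> bim_sort;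
  lact1 : forall w, lact 1 w = w;
  ract1 : forall w, ract w 1 = w;
  lactM : forall a b w, lact (a * b) w = lact a (lact b w);
  ractM : forall a b w, ract w (a * b) = ract (ract w a) b;
  lact_ract : forall a b w, ract (lact a w) b = lact a (ract w b);
  lactDl : forall a b w, lact (a + b) w = lact a w + lact b w;
  lactDr : forall a v w, lact a (v + w) = lact a v + lact a w;
  ractDl : forall v w a, ract (v + w) a = ract v a + ract w a;
  ractDr : forall w a b, ract w (a + b) = ract w a + ract w b;
  lact_scalar : forall (c : R[i]) w, lact (c%:A) w = c *: w;
  ract_scalar : forall (c : R[i]) w, ract w (c%:A) = c *: w
}.

Definition sub_bimodule (Om : bimodule) (S : Om -> Prop) : Prop :=
  [/\ S 0, forall v w, S v -> S w -> S (v + w),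
      forall a w, S w -> S (lact a w) & forall w a, S w -> S (ract w a)].

Definition generates_bimodule (Om : bimodule) (X : Om -> Prop) : Prop :=
  forall S : Om -> Prop,
    sub_bimodule S -> (forall w, X w -> S w) -> forall w, S w.

Record riem_metric := RiemMetric {
  forms :> bimodule;
  dd : {linear A -> forms};
  ip : forms -> forms -> A;
  dd_leibniz : forall a b, dd (a * b) = ract (dd a) b + lact a (dd b);
  dd_generates : generates_bimodule (fun w => exists a, w = dd a);
  ipDl : forall u v w, ip (u + v) w = ip u w + ip v w;
  ipDr : forall u v w, ip u (v + w) = ip u v + ip u w;
  ipZl : forall (c : R[i]) v w, ip (c *: v) w = c^* *: ip v w;
  ipZr : forall (c : R[i]) v w, ip v (c *: w) = c *: ip v w;
  ip_ract : forall v w a, ip v (ract w a) = ip v w * a;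
  ip_star : forall v w, star (ip v w) = ip w v;
  ip_lact : forall a v w, ip (lact a v) w = ip v (lact (star a) w);
  ip_ge0 : forall w, cstar_nonneg (ip w w);
  ip_eq0 : forall w, ip w w = 0 -> w = 0
}.

Definition cdc (M : riem_metric) (a b : A) : A := ip (dd M a) (dd M b).

Definition metrically_connected (M : riem_metric) : Prop :=
  forall a : A, cdc M a a = 0 -> exists c : R[i], a = c%:A.

Definition faithful_trace (tau : {scalar A}) : Prop :=
  [/\ forall a : A, cstar_nonneg a -> 0 <= tau a,
      forall a b : A, tau (a * b) = tau (b * a)
    & forall a : A, tau (star a * a) = 0 -> a = 0].

Definition ip_tau (tau : {scalar A}) (a b : A) : R[i] := tau (star a * b).

Definition energy_form (M : riem_metric) (tau : {scalar A}) (a b : A) : R[i] :=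
  tau (cdc M a b).

Definition real_form (E : A -> A -> R[i]) : Prop :=
  forall a b : A, E (star a) (star b) = E b a.

Definition is_laplace (tau : {scalar A}) (E : A -> A -> R[i])
    (Delta : 'End(A)) : Prop :=
  (forall a, 0 <= ip_tau tau a (Delta a)) /\
  (forall a b, E a b = ip_tau tau a (Delta b)).

Section LaplaceExists.
Variables (M : riem_metric) (tau : {scalar A}).

Definition tau_right (a b : A) : R[i]^o := tau (b * a).
Definition energy_right (a b : A) : R[i]^o := energy_form M tau (star b) a.

Fact tau_right_linear a : linear (tau_right a).
Proof. by move=> c x y; rewrite /tau_right mulrDl -scalerAl linearP. Qed.
Fact energy_right_linear a : linear (energy_right a).
Proof.
move=> c x y; rewrite /energy_right /energy_form /cdc starD starZ linearP.
by rewrite ipDl ipZl conjCK linearP.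
Qed.
HB.instance Definition _ a := GRing.isLinear.Build R[i] A R[i]^o _ (tau_right a)
  (tau_right_linear a).
HB.instance Definition _ a := GRing.isLinear.Build R[i] A R[i]^o _
  (energy_right a) (energy_right_linear a).

Definition tau_rightf (a : A) : 'Hom(A, R[i]^o) := linfun (tau_right a).
Definition energy_rightf (a : A) : 'Hom(A, R[i]^o) := linfun (energy_right a).
Fact tau_rightf_linear : linear tau_rightf.
Proof.
move=> c x y; apply/lfunP => b.
by rewrite add_lfunE scale_lfunE !lfunE /= /tau_right mulrDr -scalerAr linearP.
Qed.
Fact energy_rightf_linear : linear energy_rightf.
Proof.
move=> c x y; apply/lfunP => b; rewrite add_lfunE scale_lfunE !lfunE /=.
by rewrite /energy_right /energy_form /cdc linearP ipDr ipZr linearP.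
Qed.
HB.instance Definition _ := GRing.isLinear.Build R[i] A 'Hom(A, R[i]^o) _
  tau_rightf tau_rightf_linear.
HB.instance Definition _ := GRing.isLinear.Build R[i] A 'Hom(A, R[i]^o) _
  energy_rightf energy_rightf_linear.

Lemma laplace_exists : faithful_trace tau ->
  exists Delta, is_laplace tau (energy_form M tau) Delta.
Proof.
case=> tau_ge0 _ tau_faithful.
pose G := linfun tau_rightf; pose H := linfun energy_rightf.
have kerG : lker G == 0%VS.
  rewrite -subv0; apply/subvP => a; rewrite memv_ker lfunE /= memv0 => /eqP Ga.
  apply/eqP/tau_faithful; have /lfunP/(_ (star a)) := Ga.
  by rewrite zero_lfunE lfunE.
have imG : limg G = fullv.
  apply/eqP; rewrite eqEdim subvf limg_dim_eq ?(eqP kerG) ?capv0 //.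
  by rewrite !dimvf /dim /= muln1.
have GK f : G (G^-1%VF f) = f by rewrite limg_lfunVK // imG memvf.
have eqE a b : energy_form M tau a b = ip_tau tau a ((G^-1 \o H)%VF b).
  rewrite comp_lfunE /ip_tau.
  have /lfunP/(_ (star a)) := GK (H b).
  rewrite [G _]lfunE [H _]lfunE [LHS]lfunE [RHS]lfunE /=.
  by rewrite /tau_right /energy_right starK => <-.
exists (G^-1 \o H)%VF; split=> // a.
by rewrite -eqE; apply/tau_ge0/ip_ge0.
Qed.

End LaplaceExists.

Record proper_cproj := ProperCProj {
  cproj :> A;
  cproj_star : star cproj = cproj;
  cproj_idem : cproj * cproj = cproj;
  cproj_central : forall a : A, cproj * a = a * cproj;
  cproj_neq0 : cproj != 0;
  cproj_neq1 : cproj != 1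
}.

Lemma star0 : star (0 : A) = 0.
Proof. by apply: (@addrI _ (star 0)); rewrite -starD !addr0. Qed.

Lemma starN (x : A) : star (- x) = - star x.
Proof. by apply: (@addrI _ (star x)); rewrite -starD !subrr star0. Qed.

Lemma star1 : star (1 : A) = 1.
Proof. by rewrite -[LHS]mulr1 -{2}(starK (1 : A)) -starM mulr1 starK. Qed.

Section Complement.
Variable P : proper_cproj.

Lemma compl_star : star (1 - cproj P) = 1 - cproj P.
Proof. by rewrite starD starN star1 cproj_star. Qed.
Lemma compl_idem : (1 - cproj P) * (1 - cproj P) = 1 - cproj P.
Proof.
by rewrite mulrBl mul1r mulrBr mulr1 cproj_idem subrr subr0.
Qed.
Lemma compl_central (a : A) : (1 - cproj P) * a = a * (1 - cproj P).
Proof. by rewrite mulrBl mulrBr mul1r mulr1 cproj_central. Qed.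
Lemma compl_neq0 : 1 - cproj P != 0.
Proof. by rewrite subr_eq0 eq_sym cproj_neq1. Qed.
Lemma compl_neq1 : 1 - cproj P != 1.
Proof.
by rewrite -subr_eq0 addrAC subrr sub0r oppr_eq0 cproj_neq0.
Qed.

Definition cprojC : proper_cproj :=
  ProperCProj compl_star compl_idem compl_central compl_neq0 compl_neq1.

End Complement.

Section Corner.
Variable P : proper_cproj.

Definition corner_space : {vspace A} := limg (amull (cproj P)).

Lemma memv_corner (a : A) : (a \in corner_space) = (cproj P * a == a).
Proof.
apply/memv_imgP/eqP => [[b _ ->]|<-]; last by exists a; rewrite ?memvf ?lfunE.
by rewrite lfunE /= mulrA cproj_idem.
Qed.

Lemma corner_is_algid : is_algid (cproj P) corner_space.
Proof.
split=> [|| a]; rewrite ?cproj_neq0 ?memv_corner ?cproj_idem // => /eqP Pa.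
by rewrite -cproj_central Pa.
Qed.

Lemma corner_is_aspace : is_aspace corner_space.
Proof.
apply/andP; split; first by apply/has_algidP; exists (cproj P); exact: corner_is_algid.
apply/prodvP => a b; rewrite !memv_corner => /eqP Pa _.
by rewrite mulrA Pa.
Qed.

Definition corner_aspace : {aspace A} := ASpace corner_is_aspace.

(* The quotient algebra p A, whose unit is p (see val_corner1). *)
Definition corner : Type := subvs_of corner_aspace.

HB.instance Definition _ := Falgebra.on corner.

Lemma corner_valP (x : corner) : cproj P * vsval x = vsval x.
Proof. by apply/eqP; rewrite -memv_corner; exact: subvsP. Qed.

Lemma val_corner1 : vsval (1 : corner) = cproj P.
Proof.
have pin : cproj P \in corner_aspace by rewrite memv_corner cproj_idem.
by rewrite -[RHS](algidl pin) -cproj_central; exact/esym/(corner_valP 1).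
Qed.

Lemma corner_star_subproof (x : corner) : star (vsval x) \in corner_aspace.
Proof.
by rewrite memv_corner cproj_central -{1}cproj_star -starM corner_valP.
Qed.

Definition corner_star (x : corner) : corner := Subvs (corner_star_subproof x).
Definition corner_norm (x : corner) : R := cstar_norm (vsval x).

Lemma corner_starK : involutive corner_star.
Proof. by move=> x; apply: val_inj; rewrite /= starK. Qed.
Lemma corner_starD : {morph corner_star : x y / x + y}.
Proof. by move=> x y; apply: val_inj; rewrite /= starD. Qed.
Lemma corner_starZ (c : R[i]) (x : corner) :
  corner_star (c *: x) = c^* *: corner_star x.
Proof. by apply: val_inj; rewrite /= starZ. Qed.
Lemma corner_starM (x y : corner) :
  corner_star (x * y) = corner_star y * corner_star x.
Proof. by apply: val_inj; rewrite /= starM. Qed.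
Lemma corner_normD (x y : corner) :
  corner_norm (x + y) <= corner_norm x + corner_norm y.
Proof. exact: cstar_normD. Qed.
Lemma corner_normZ (c : R[i]) (x : corner) :
  corner_norm (c *: x) = complex.Re `|c| * corner_norm x.
Proof. exact: cstar_normZ. Qed.
Lemma corner_norm0_eq0 (x : corner) : corner_norm x = 0 -> x = 0.
Proof. by move/cstar_norm0_eq0 => x0; apply: val_inj. Qed.
Lemma corner_normM (x y : corner) :
  corner_norm (x * y) <= corner_norm x * corner_norm y.
Proof. exact: cstar_normM. Qed.
Lemma corner_normE (x : corner) :
  corner_norm (corner_star x * x) = corner_norm x ^+ 2.
Proof. exact: cstar_normE. Qed.

HB.instance Definition _ := isCStar.Build R corner
  corner_starK corner_starD corner_starZ corner_starM
  corner_normD corner_normZ corner_norm0_eq0 corner_normM corner_normE.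

Definition corner_incl : 'Hom(corner, A) := linfun vsval.

(* a |-> p a, corestricted to p A *)
Definition corner_quot : 'Hom(A, corner) :=
  (linfun (vsproj corner_aspace) \o amull (cproj P))%VF.

Lemma corner_inclE (x : corner) : corner_incl x = vsval x.
Proof. by rewrite lfunE. Qed.

Lemma val_corner_quot (a : A) : vsval (corner_quot a) = cproj P * a.
Proof.
have Pa : cproj P * a \in corner_aspace by rewrite memv_corner mulrA cproj_idem.
by rewrite comp_lfunE !lfunE /= vsprojK.
Qed.

End Corner.

Definition block (P Q : proper_cproj) (Delta : 'End(A)) :
    'Hom(corner Q, corner P) :=
  (corner_quot P \o Delta \o corner_incl Q)%VF.

(* The upper right block is the adjoint J^* of J since Delta is self-adjoint;
   inv_lfun is the inverse of a bijective linear map. *)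
Definition quotient_laplace (P : proper_cproj) (Delta : 'End(A)) :
    'End(corner P) :=
  let Rb := block P P Delta in
  let J := block (cprojC P) P Delta in
  let Jstar := block P (cprojC P) Delta in
  let S := block (cprojC P) (cprojC P) Delta in
  Rb - (Jstar \o S^-1 \o J)%VF.

Definition quotient_form (P : proper_cproj) (tau : {scalar A})
    (Delta : 'End(A)) (b b' : corner P) : R[i] :=
  ip_tau tau (vsval b) (vsval (quotient_laplace P Delta b')).

End CStarTheory.

Arguments proper_cproj {R} A.
Arguments riem_metric {R} A.
Arguments bimodule {R} A.

(* Main.v *)
Require Import Defs.
From HB Require Import structures.
From mathcomp Require Import all_boot all_order all_algebra all_field.
From mathcomp Require Import ring.
From mathcomp Require Import reals complex.

Set Implicit Arguments.
Unset Strict Implicit.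
Unset Printing Implicit Defensive.

Import Order.TTheory GRing.Theory Num.Theory.
Local Open Scope ring_scope.

(** The proof characterizes the Laplace operators of real energy forms by a
    condition that survives Schur complements.

    A derivation of a finite-dimensional C*-algebra is inner
    ([derivation_inner]), so a metric is given by a vector [xi] of its
    bimodule with [d a = a xi - xi a].  The map [Phi a = <xi, a xi>] is
    completely positive, and expanding [<d a, d b>] expresses the CdC by [Phi]
    alone ([metric_cdc_commutator]).  Applying the trace, and symmetrizing by
    means of the reality of the form, turns the Laplace operator into
    [Delta x = k x + x k - Psi x], with [Psi] completely positive, symmetric
    for the trace, and [Psi 1 = 2 k] ([laplace_lindblad]).  Conversely, let
    [Phi] be completely positive.  Inside the space of linear endomorphisms,
    with the actions [(a L)(x) = L (x a)] and [(L c)(x) = L x c], the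
    endomorphism [Phi] is a cyclic vector with [<a Phi, b Phi> = Phi (a^* b)],
    so [b |-> b Phi - Phi b] is the derivation of a metric ([cp_metric]), and
    its CdC is given by the same expression in [Phi].

    In block form with respect to [p] and [q = 1 - p], the off-diagonal blocks
    of [Delta] are minus those of [Psi].  Hence [R - J^* S^-1 J] is again
    [x |-> kB x + x kB - PsiB x], where
    [PsiB = Psi_pp + Psi_pq S^-1 Psi_qp] is symmetric and [PsiB 1 = 2 kB].  By
    [cp_metric] applied to half of [PsiB], it remains to show that [S^-1] is
    completely positive ([inverse_cp]).  For a large scalar [s],
    [2 s S = U - V] with [U x = (k + s) x (k + s)] and
    [V x = (k - s) x (k - s) + 2 s Psi x].  Both [U^-1] and [V] are completely
    positive, and [U^-1 V] is a strict contraction for the norm defined by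
    [U], so [S^-1] is the sum of a Neumann series with completely positive
    terms.

    The new metric is metrically connected because the quotient form at [b] is
    the energy of the harmonic extension [b - S^-1 J b], which is a multiple
    of [1] if its energy vanishes.

    Complete positivity of [T] is used in the scalar form
    [0 <= tau (sum_ij c_i^* T (a_i^* a_j) c_j)], which is evidently stable
    under sums and limits.  For compositions the matrix [T (a_i^* a_j)] has to
    be written as [sum_l v_li^* v_lj] ([tau_pos_matrix_factor]).  This is
    reduced to the spectral theorem for scalar matrices by averaging over a
    family [e_i] with [x = sum_i tau (e_i^* x) e_i]; the same averaging shows
    that derivations are inner. *)

(** * Positive forms and positive scalar matrices *)

Section PositiveForms.
Variables (C : numClosedFieldType) (V : lmodType C) (f : V -> V -> C).
Hypotheses (fDl : forall u v w, f (u + v) w = f u w + f v w)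
           (fDr : forall u v w, f u (v + w) = f u v + f u w)
           (fZl : forall c u v, f (c *: u) v = c^* * f u v)
           (fZr : forall c u v, f u (c *: v) = c * f u v)
           (f_ge0 : forall u, 0 <= f u u).

(** Polarization at [u + v] and at [u + 'i *: v]. *)
Lemma form_herm u v : f u v = (f v u)^*.
Proof.
have re w : f w w \is Num.real by apply/ger0_real.
have /CrealP h1 : f u v + f v u \is Num.real.
  have -> : f u v + f v u = f (u + v) (u + v) - f u u - f v v.
    by rewrite !fDl !fDr; ring.
  by rewrite !rpredB.
have /CrealP h2 : 'i * (f u v - f v u) \is Num.real.
  have -> : 'i * (f u v - f v u) =
            f (u + 'i *: v) (u + 'i *: v) - f u u - f v v.
    have ii : 'i * 'i = -1 :> C by rewrite -expr2 sqrCi.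
    by rewrite !fDl !fDr !fZl !fZr conjCi; ring: ii.
  by rewrite !rpredB.
have {}h2 : (f u v)^* - (f v u)^* = f v u - f u v.
  apply: (mulfI (neq0Ci C)); apply: oppr_inj; move: h2.
  by rewrite rmorphM /= conjCi rmorphB /= mulNr => ->; ring.
move: h1; rewrite rmorphD /= => h1.
apply: (@mulfI _ 2); first by rewrite pnatr_eq0.
have -> : 2 * f u v = (f u v + f v u) - (f v u - f u v) by ring.
by rewrite -h1 -h2; ring.
Qed.

(** The form may be degenerate: if [f u u] and [f v v] both vanish, positivity
    at [u - f v u *: v] forces [f u v = 0]. *)
Lemma form_CauchySchwarz u v : `|f u v| ^+ 2 <= f u u * f v v.
Proof.
wlog: u v / 0 < f v v => [hw|v_gt0].
  have := f_ge0 v; rewrite le0r => /orP[/eqP v0|]; last exact: hw.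
  have := f_ge0 u; rewrite le0r => /orP[/eqP u0|/(hw v u)]; last first.
    by rewrite form_herm norm_conjC mulrC.
  have := f_ge0 (u - f v u *: v).
  rewrite -scaleNr !fDl !fDr !fZl !fZr u0 v0 rmorphN /= -(form_herm u v).
  rewrite [f v u]form_herm !(mulr0, mul0r, addr0, add0r) !mulNr -opprD oppr_ge0.
  rewrite [_^* * _]mulrC -normCK -mulr2n pmulrn_lle0 //.
have fvv : (f v v)^* = f v v by apply/CrealP/ger0_real/ltW.
have := f_ge0 (f v v *: u - f v u *: v).
rewrite -scaleNr !fDl !fDr !fZl !fZr rmorphN /= -(form_herm u v) fvv.
rewrite [X in 0 <= X -> _](_ : _ = f v v * (f u u * f v v - f u v * f v u));
  last by ring.
by rewrite pmulr_rge0 // subr_ge0 [f v u]form_herm -normCK.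
Qed.

End PositiveForms.

Section PositiveMatrices.
Variables (C : numClosedFieldType) (n : nat) (G : 'M[C]_n).
Hypothesis G_ge0 : forall u : 'I_n -> C,
  0 <= \sum_i \sum_j (u i)^* * G i j * u j.

Local Open Scope sesquilinear_scope.

Let g (u v : 'cV[C]_n) : C := \sum_i \sum_j (u i 0)^* * G i j * v j 0.

(** A matrix defines a form on column vectors, to which [form_herm] applies. *)
Lemma posmx_herm i j : G i j = (G j i)^*.
Proof.
have gE k l : G k l = g (delta_mx k 0) (delta_mx l 0).
  rewrite /g (bigD1 k) //= (bigD1 l) //= !mxE !eqxx conjC1 mulr1 mul1r.
  rewrite !big1 ?addr0 // => [k' /negPf kk'|l' /negPf ll'].
    by apply: big1 => l' _; rewrite mxE kk' conjC0 !mul0r.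
  by rewrite !mxE ll' mulr0.
rewrite !gE; apply: form_herm => [u v w|u v w|c u v|c u v|u]; last exact: G_ge0.
- rewrite -big_split; apply: eq_bigr => k _; rewrite -big_split.
  by apply: eq_bigr => l _; rewrite mxE rmorphD !mulrDl.
- rewrite -big_split; apply: eq_bigr => k _; rewrite -big_split.
  by apply: eq_bigr => l _; rewrite mxE !mulrDr.
- rewrite mulr_sumr; apply: eq_bigr => k _; rewrite mulr_sumr.
  by apply: eq_bigr => l _; rewrite mxE rmorphM !mulrA.
- rewrite mulr_sumr; apply: eq_bigr => k _; rewrite mulr_sumr.
  by apply: eq_bigr => l _; rewrite mxE; ring.
Qed.

(** The eigenvalue [d m] is the value of the quadratic form at the [m]-th
    eigenvector, the conjugate of the [m]-th row of [P]. *)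
Lemma posmx_spectral : exists (P : 'M[C]_n) (d : 'I_n -> C),
  [/\ forall i j, \sum_k P i k * (P j k)^* = (i == j)%:R,
      forall m, 0 <= d m
    & forall i j, G i j = \sum_m (P m i)^* * d m * P m j].
Proof.
have Gherm : G \is hermsymmx.
  by apply/is_hermitianmxP/matrixP => i j; rewrite expr0 scale1r !mxE posmx_herm.
have /orthomx_spectralP := hermitian_normalmx Gherm.
have Pu := spectral_unitarymx G; rewrite invmx_unitary //.
set P := spectralmx G in Pu *; set d := spectral_diag G => Geq.
have PP i j : \sum_k P i k * (P j k)^* = (i == j)%:R.
  have /unitarymxP/matrixP/(_ i j) := Pu; rewrite !mxE => <-.
  by apply: eq_bigr => k _; rewrite !mxE.
have GE i j : G i j = \sum_m (P m i)^* * d 0 m * P m j.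
  rewrite {1}Geq mxE; apply: eq_bigr => m _; rewrite mxE (bigD1 m) //= !mxE eqxx.
  by rewrite big1 ?addr0 // => k /negPf km; rewrite !mxE km mulr0n mulr0.
exists P, (fun m => d 0 m); split=> // m.
have := G_ge0 (fun j => (P m j)^*); congr (0 <= _).
have step i : \sum_j (P m i)^*^* * G i j * (P m j)^* =
    (P m i) * (P m i)^* * d 0 m.
  under eq_bigr do rewrite conjCK GE mulr_sumr mulr_suml.
  rewrite exchange_big /= (bigD1 m) //= [X in _ + X]big1 ?addr0.
    transitivity (P m i * (P m i)^* * d 0 m * \sum_k P m k * (P m k)^*).
      by rewrite mulr_sumr; apply: eq_bigr => k _; ring.
    by rewrite PP eqxx mulr1.
  move=> l /negPf lm.
  transitivity (P m i * (P l i)^* * d 0 l * \sum_k P l k * (P m k)^*).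
    by rewrite mulr_sumr; apply: eq_bigr => k _; ring.
  by rewrite PP lm mulr0.
by under eq_bigr do rewrite step; rewrite -mulr_suml PP eqxx mul1r.
Qed.

(** Scale the rows of the unitary matrix by the square roots of the
    eigenvalues. *)
Lemma posmx_factor : exists X : 'I_n -> 'I_n -> C,
  forall i j, G i j = \sum_m (X m i)^* * X m j.
Proof.
have [P [d [_ d_ge0 GE]]] := posmx_spectral.
exists (fun m i => sqrtC (d m) * P m i) => i j; rewrite GE; apply: eq_bigr => m _.
rewrite rmorphM /= [(sqrtC _)^*](CrealP _) ?ger0_real ?sqrtC_ge0 //.
by rewrite -{1}[d m]sqrtCK; ring.
Qed.

End PositiveMatrices.

Lemma posform_factor (C : numClosedFieldType) (T : finType) (G : T -> T -> C) :
    (forall u : T -> C, 0 <= \sum_i \sum_j (u i)^* * G i j * u j) ->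
  exists X : 'I_#|T| -> T -> C, forall i j, G i j = \sum_m (X m i)^* * X m j.
Proof.
move=> G_ge0; pose M : 'M[C]_#|T| := \matrix_(i, j) G (enum_val i) (enum_val j).
have M_ge0 u : 0 <= \sum_i \sum_j (u i)^* * M i j * u j.
  have := G_ge0 (u \o enum_rank); congr (0 <= _).
  rewrite big_enum_val; apply: eq_bigr => i _; rewrite big_enum_val.
  by apply: eq_bigr => j _; rewrite mxE /= !enum_valK.
have [X XE] := posmx_factor M_ge0.
exists (fun m t => X m (enum_rank t)) => i j; rewrite -XE mxE.
by rewrite !enum_rankK.
Qed.

Lemma interpolation (F : fieldType) (g : F -> F) (s : seq F) :
  exists r : {poly F}, forall x, x \in s -> r.[x] = g x.
Proof.
elim: s => [|y s [r rP]]; first by exists 0.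
have [ys|nys] := boolP (y \in s).
  by exists r => x; rewrite inE => /predU1P[->|]; apply: rP.
pose q := \prod_(z <- s) ('X - z%:P).
have qy : q.[y] != 0 by rewrite -/(root q y) root_prod_XsubC.
exists (r + ((g y - r.[y]) / q.[y]) *: q) => x; rewrite inE hornerD hornerZ.
case/predU1P=> [->|xs]; first by rewrite divfK // addrC subrK.
by rewrite [q.[x]](rootP _) ?root_prod_XsubC // mulr0 addr0 rP.
Qed.

(** * Traces and tight frames *)

Lemma star_sum (R : realType) (A : cstarAlgType R) (I : Type) (r : seq I)
    (P : pred I) (F : I -> A) :
  star (\sum_(i <- r | P i) F i) = \sum_(i <- r | P i) star (F i).
Proof. by apply: (big_morph _ (@starD _ _)); exact: star0. Qed.

Lemma mulmx_delta (F : nzRingType) (n : nat) (M N : 'M[F]_n) (u : 'I_n -> F) i :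
  M *m N = 1%:M -> \sum_k (\sum_j M i j * N j k) * u k = u i.
Proof.
move=> /matrixP MN.
have MNE k : \sum_j M i j * N j k = (i == k)%:R by have := MN i k; rewrite !mxE.
rewrite (bigD1 i) //= MNE eqxx mul1r big1 ?addr0 // => k /negPf ki.
by rewrite MNE eq_sym ki mul0r.
Qed.

Lemma injective_endK (F : fieldType) (U : vectType F) (T : 'End(U)) :
    (forall x, T x = 0 -> x = 0) ->
  forall x, T (T^-1%VF x) = x /\ T^-1%VF (T x) = x.
Proof.
move=> T_inj; have kerT : lker T == 0%VS.
  rewrite -subv0; apply/subvP => x; rewrite memv_ker memv0 => /eqP Tx0.
  by apply/eqP/T_inj.
have imT : limg T = fullv.
  by apply/eqP; rewrite eqEdim subvf limg_dim_eq ?(eqP kerT) ?capv0 /=.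
move=> x; split; first by rewrite limg_lfunVK // imT memvf.
by rewrite lker0_lfunK.
Qed.

Lemma unit_of_injective (F : fieldType) (A : falgType F) (a : A) :
  (forall x, a * x = 0 -> x = 0) -> a \is a GRing.unit.
Proof.
move=> a_inj; have ab : a * (amull a)^-1%VF 1 = 1.
  have [] // := @injective_endK _ _ (amull a) _ 1; last by rewrite lfunE.
  by move=> x; rewrite lfunE /=; exact: a_inj.
apply/unitrP; exists ((amull a)^-1%VF 1); split=> //.
apply/eqP; rewrite -subr_eq0; apply/eqP/a_inj.
by rewrite mulrBr mulrA ab mul1r mulr1 subrr.
Qed.

Section Trace.
Variables (R : realType) (A : cstarAlgType R) (tau : {scalar A}).
Hypothesis tauP : faithful_trace tau.

Lemma tauZ (c : R[i]) (a : A) : tau (c *: a) = c * tau a.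
Proof. exact: linearZ. Qed.

Lemma tauD (a b : A) : tau (a + b) = tau a + tau b.
Proof. exact: linearD. Qed.

Lemma tauB (a b : A) : tau (a - b) = tau a - tau b.
Proof. exact: linearB. Qed.

Lemma tauC (a b : A) : tau (a * b) = tau (b * a).
Proof. by case: tauP. Qed.

Lemma tau_sq_ge0 (a : A) : 0 <= tau (star a * a).
Proof. by case: tauP => h _ _; apply: h; exists a. Qed.

Lemma tau_sq_eq0 (a : A) : tau (star a * a) = 0 -> a = 0.
Proof. by case: tauP => _ _; apply. Qed.

Lemma tau_nondeg (x : A) : (forall y, tau (y * x) = 0) -> x = 0.
Proof. by move=> h; apply/tau_sq_eq0/h. Qed.

Lemma tau_form_herm (a b : A) : tau (star a * b) = (tau (star b * a))^*.
Proof.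
apply: (@form_herm _ A (fun a b => tau (star a * b))) => [u v w|u v w|c u v|c u v|u].
- by rewrite starD mulrDl linearD.
- by rewrite mulrDr linearD.
- by rewrite starZ -scalerAl linearZ.
- by rewrite -scalerAr linearZ.
- exact: tau_sq_ge0.
Qed.

Lemma tau_star (a : A) : tau (star a) = (tau a)^*.
Proof. by have := tau_form_herm a 1; rewrite mulr1 star1 mul1r. Qed.

(** Any basis has an invertible positive Gram matrix [G]; a factorization of
    [G^-1] turns the basis into a tight frame, which replaces an orthonormal
    basis below. *)
Lemma tau_frame_exists : exists (n : nat) (e : 'I_n -> A),
  forall x, x = \sum_i tau (star (e i) * x) *: e i.
Proof.
pose n := \dim {:A}; pose b := vbasis {:A}.
have xE x : x = \sum_(i < n) coord b i x *: b`_i by exact/coord_vbasis/memvf.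
pose lin (u : 'I_n -> R[i]) : A := \sum_i u i *: b`_i.
have tau_lin u x : tau (star (lin u) * x) = \sum_i (u i)^* * tau (star b`_i * x).
  rewrite star_sum mulr_suml linear_sum; apply: eq_bigr => i _.
  by rewrite starZ -scalerAl linearZ.
pose G : 'M[R[i]]_n := \matrix_(i, j) tau (star b`_i * b`_j).
have GE u i : \sum_j G i j * u j = tau (star b`_i * lin u).
  rewrite mulr_sumr linear_sum; apply: eq_bigr => j _.
  by rewrite mxE -scalerAr linearZ /= mulrC.
have G_ge0 u : 0 <= \sum_i \sum_j (u i)^* * G i j * u j.
  have -> : \sum_i \sum_j (u i)^* * G i j * u j = tau (star (lin u) * lin u).
    rewrite tau_lin; apply: eq_bigr => i _; rewrite -GE mulr_sumr.
    by apply: eq_bigr => j _; rewrite mulrA.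
  exact: tau_sq_ge0.
(* A vector in the kernel of G gives an element of norm 0. *)
have Gu : G \in unitmx.
  rewrite unitmxE unitfE; apply/negP => /det0P[v v_neq0 vG].
  have lin0 : lin (fun i => (v 0 i)^*) = 0.
    apply: tau_sq_eq0; rewrite {2}/lin mulr_sumr linear_sum big1 // => j _.
    rewrite -scalerAr linearZ /= tau_lin.
    have /rowP/(_ j) := vG; rewrite !mxE => vGj.
    rewrite [X in _ * X](_ : _ = 0) ?mulr0 // -[RHS]vGj.
    by apply: eq_bigr => i _; rewrite conjCK mxE.
  case/eqP: v_neq0; apply/rowP => i; rewrite mxE.
  apply/eqP; rewrite -conjC_eq0; apply/eqP; move: i.
  by have /freeP := basis_free (vbasisP {:A}); apply.
have H_ge0 u : 0 <= \sum_i \sum_j (u i)^* * invmx G i j * u j.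
  pose w i := \sum_j invmx G i j * u j.
  have uE i : u i = \sum_j G i j * w j.
    rewrite -[LHS](mulmx_delta u i (mulmxV Gu)).
    under eq_bigr do rewrite mulr_suml.
    rewrite exchange_big; apply: eq_bigr => j _; rewrite mulr_sumr.
    by apply: eq_bigr => k _; rewrite mulrA.
  have -> : \sum_i \sum_j (u i)^* * invmx G i j * u j =
            \sum_i \sum_j (w i)^* * G i j * w j.
    transitivity (\sum_i (u i)^* * w i).
      by apply: eq_bigr => i _; rewrite mulr_sumr; apply: eq_bigr => j _; rewrite mulrA.
    under eq_bigr => i _ do rewrite uE rmorph_sum mulr_suml.
    rewrite exchange_big; apply: eq_bigr => j _; apply: eq_bigr => i _.
    by rewrite rmorphM /= -(posmx_herm G_ge0 j i); ring.
  exact: G_ge0.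
have [X XE] := posmx_factor H_ge0.
exists n, (fun m => lin (fun i => (X m i)^*)) => x.
have xiE i : coord b i x = \sum_j invmx G i j * tau (star b`_j * x).
  rewrite -[LHS](mulmx_delta (coord b ^~ x) i (mulVmx Gu)).
  under eq_bigr do rewrite mulr_suml.
  rewrite exchange_big; apply: eq_bigr => j _; rewrite {2}(xE x) -GE mulr_sumr.
  by apply: eq_bigr => k _; rewrite mulrA.
rewrite {1}(xE x).
transitivity (\sum_i \sum_m ((X m i)^* * \sum_j X m j * tau (star b`_j * x)) *: b`_i).
  apply: eq_bigr => i _; rewrite -scaler_suml; congr (_ *: _); rewrite xiE.
  under eq_bigr => j _ do rewrite XE mulr_suml.
  rewrite exchange_big; apply: eq_bigr => m _; rewrite mulr_sumr.
  by apply: eq_bigr => j _; rewrite mulrA.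
rewrite exchange_big; apply: eq_bigr => m _; rewrite tau_lin scaler_sumr.
apply: eq_bigr => i _; rewrite scalerA mulrC; congr (_ * _ *: _).
by apply: eq_bigr => j _; rewrite conjCK.
Qed.

End Trace.

Lemma linear_comb (F : nzRingType) (U V : lmodType F) (f : U -> V) (I : finType)
    (c : I -> F) (x : I -> U) :
  linear f -> f (\sum_i c i *: x i) = \sum_i c i *: f (x i).
Proof.
move=> flin; have f0 : f 0 = 0.
  by have := flin (-1) 0 0; rewrite scaler0 addr0 scaleN1r addNr.
elim/big_rec2: _ => // i y1 y2 _ <-; exact: flin.
Qed.

Section Frame.
Variables (R : realType) (A : cstarAlgType R) (tau : {scalar A}).
Hypothesis tauP : faithful_trace tau.
Variables (n : nat) (e : 'I_n -> A).
Hypothesis eP : forall x, x = \sum_i tau (star (e i) * x) *: e i.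

(** The adjoint of the expansion of [star x]; it says that the [star (e i)]
    form a tight frame too. *)
Lemma frame_dual x : x = \sum_i tau (x * e i) *: star (e i).
Proof.
apply: (can_inj (@starK _ A)); rewrite [LHS]eP star_sum; apply: eq_bigr => i _.
by rewrite starZ starK -starM (tau_star tauP).
Qed.

(** The element [sum_i e_i^* (x) e_i] is a Casimir element: multiplying its
    left leg by [a] on the left amounts to multiplying its right leg by [a] on
    the right.  Both sides expand with the coefficients
    [tau (a e_i^* e_j)]. *)
Lemma frame_casimir (V : lmodType R[i]) (B : A -> A -> V) a :
    (forall x, linear (B x)) -> (forall y, linear (B^~ y)) ->
  \sum_i B (a * star (e i)) (e i) = \sum_i B (star (e i)) (e i * a).
Proof.
move=> Blin_r Blin_l.
transitivity (\sum_i \sum_j tau (a * star (e i) * e j) *: B (star (e j)) (e i)).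
  apply: eq_bigr => i _; rewrite {1}[a * _]frame_dual.
  exact: (linear_comb (f := B^~ (e i))).
rewrite exchange_big; apply: eq_bigr => j _.
rewrite [e j * a]eP (linear_comb (f := B _)) //; apply: eq_bigr => i _.
by rewrite -mulrA (tauC tauP) mulrA.
Qed.

(** The image of the Casimir element under multiplication.  It is central and
    invertible, and dividing by it normalizes averages over the frame. *)
Definition frame_index := \sum_i star (e i) * e i.

Lemma frame_index_central a : a * frame_index = frame_index * a.
Proof.
have := @frame_casimir A (fun x y => x * y) a; rewrite mulr_sumr mulr_suml.
under eq_bigr do rewrite -mulrA; move=> ->.
- by apply: eq_bigr => i _; rewrite mulrA.
- by move=> x c u v; rewrite mulrDr scalerAr.
- by move=> y c u v; rewrite mulrDl scalerAl.
Qed.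

Lemma frame_index_star : star frame_index = frame_index.
Proof. by rewrite star_sum; apply: eq_bigr => i _; rewrite starM starK. Qed.

Lemma tau_frame_index x :
  tau (star x * frame_index * x) = \sum_i tau (star (e i * x) * (e i * x)).
Proof.
rewrite mulr_sumr mulr_suml linear_sum; apply: eq_bigr => i _.
by rewrite starM !mulrA.
Qed.

Lemma frame_index_unit : frame_index \is a GRing.unit.
Proof.
apply: unit_of_injective => x zx0.
have := tau_frame_index x; rewrite -mulrA zx0 mulr0 linear0 => /esym/eqP.
rewrite psumr_eq0 => [/allP ex0|i _]; last exact: tau_sq_ge0.
rewrite -[x]mul1r [1]eP mulr_suml big1 // => i _.
rewrite -scalerAl (tau_sq_eq0 tauP (eqP (ex0 i _))) ?scaler0 //.
Qed.

(** * Positive elements and positive matrices over the algebra *)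

(** Positivity of the left multiplication by [y] on L^2. *)
Definition tau_pos (y : A) := forall d, 0 <= tau (star d * y * d).

(** In the frame, left multiplication by [y] is a positive scalar matrix
    [P^* d P], and passing to matrices is multiplicative and injective.  A
    polynomial in [y] that takes the value [sqrtC x] at every eigenvalue [x]
    is a square root of [y].  Since the matrix of [1] is the identity only for
    an orthonormal frame, the polynomial is taken without constant term:
    [x * r(x)] where [r] interpolates [sqrtC x / x]. *)
Lemma tau_pos_nonneg y : tau_pos y -> cstar_nonneg y.
Proof.
move=> y_pos; pose L x i j := tau (star (e i) * x * e j).
have LM x x' i j : L (x * x') i j = \sum_k L x i k * L x' k j.
  rewrite /L mulrA -(mulrA _ x') [x' * e j]eP mulr_sumr linear_sum.
  by apply: eq_bigr => k _; rewrite -scalerAr linearZ /= mulrC mulrA.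
have L_inj x x' : (forall i j, L x i j = L x' i j) -> x = x'.
  move=> LL; apply/eqP; rewrite -subr_eq0; apply/eqP.
  have xe j : (x - x') * e j = 0.
    rewrite [LHS]eP big1 // => i _; rewrite mulrA mulrBr mulrBl linearB /=.
    by rewrite -/(L x i j) -/(L x' i j) LL subrr scale0r.
  rewrite -[LHS]mulr1 [1]eP mulr_sumr big1 // => j _.
  by rewrite -scalerAr xe scaler0.
have Lstar x i j : L (star x) i j = (L x j i)^*.
  by rewrite /L -(tau_star tauP) !starM starK mulrA.
have L_ge0 u : 0 <= \sum_i \sum_j (u i)^* * (\matrix_(i, j) L y i j) i j * u j.
  have := y_pos (\sum_j u j *: e j); congr (0 <= _).
  rewrite star_sum !mulr_suml linear_sum; apply: eq_bigr => i _.
  rewrite mulr_sumr linear_sum; apply: eq_bigr => j _.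
  by rewrite mxE starZ -![in LHS]scalerAl -[in LHS]scalerAr !tauZ /L; ring.
have [P [d [PP d_ge0 LE]]] := posmx_spectral L_ge0.
pose D (a : 'I_n -> R[i]) i j := \sum_m (P m i)^* * a m * P m j.
have DM a b i j : \sum_k D a i k * D b k j = D (fun m => a m * b m) i j.
  transitivity (\sum_m \sum_l ((P m i)^* * a m * b l * P l j) *
                  \sum_k P m k * (P l k)^*).
    under eq_bigr => k _ do rewrite mulr_suml.
    rewrite exchange_big; apply: eq_bigr => m _.
    under eq_bigr => k _ do rewrite mulr_sumr.
    rewrite exchange_big; apply: eq_bigr => l _.
    by rewrite mulr_sumr; apply: eq_bigr => k _; ring.
  apply: eq_bigr => m _; rewrite (bigD1 m) //= PP eqxx mulr1 big1 ?addr0 ?mulrA //.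
  by move=> l /negPf lm; rewrite PP eq_sym lm mulr0.
have LD i j : L y i j = D d i j by have := LE i j; rewrite mxE.
have LX k i j : L (y ^+ k.+1) i j = D (fun m => d m ^+ k.+1) i j.
  elim: k i j => [|k IHk] i j; first by rewrite expr1 LD.
  rewrite exprSr LM; under eq_bigr do rewrite IHk LD.
  by rewrite DM; apply: eq_bigr => m _; rewrite -exprSr.
have [r rP] := interpolation (fun x => sqrtC x / x) [seq d m | m : 'I_n].
pose b := \sum_(k < size r) r`_k *: y ^+ k.+1.
have Lb i j : L b i j = D (fun m => sqrtC (d m)) i j.
  rewrite /L mulr_sumr mulr_suml linear_sum.
  transitivity (\sum_(k < size r) r`_k * D (fun m => d m ^+ k.+1) i j).
    by apply: eq_bigr => k _; rewrite -LX -scalerAr -scalerAl linearZ.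
  under eq_bigr do rewrite mulr_sumr.
  rewrite exchange_big; apply: eq_bigr => m _.
  transitivity ((P m i)^* * (d m * r.[d m]) * P m j).
    rewrite horner_coef mulr_sumr mulr_sumr mulr_suml; apply: eq_bigr => k _.
    by rewrite exprS; ring.
  rewrite rP ?map_f ?mem_enum //; congr (_ * _ * _).
  have [->|dm0] := eqVneq (d m) 0; first by rewrite sqrtC0 mul0r.
  by rewrite mulrC divfK.
exists b; apply: L_inj => i j; rewrite LM LD.
transitivity (\sum_k D (fun m => sqrtC (d m)) i k * D (fun m => sqrtC (d m)) k j).
  by rewrite DM; apply: eq_bigr => m _; rewrite -expr2 sqrtCK.
apply: eq_bigr => k _; rewrite Lstar !Lb rmorph_sum /=; congr (_ * _).
apply: eq_bigr => m _; rewrite !rmorphM /= conjCK.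
by rewrite [(sqrtC _)^*](CrealP _) ?ger0_real ?sqrtC_ge0 //; ring.
Qed.

(** This replaces the square root in the algebra of matrices over [A].  The
    scalars [tau (e_k y_ij star e_l)] form a positive matrix, hence factor
    ([posform_factor]), and summing back against [e_k^*] and [e_l] recovers
    [y_ij * frame_index].  The index is then divided out through a square root
    of its inverse. *)
Lemma tau_pos_matrix_factor m (y : 'I_m -> 'I_m -> A) :
    (forall c, 0 <= tau (\sum_i \sum_j star (c i) * y i j * c j)) ->
  exists k (v : 'I_k -> 'I_m -> A),
    forall i j, y i j = \sum_l star (v l i) * v l j.
Proof.
move=> y_ge0; have zu := frame_index_unit; set z := frame_index in zu.
have [w wE] : cstar_nonneg z^-1.
  apply: tau_pos_nonneg => d.
  have zd : z * (z^-1 * d) = d by rewrite mulrA divrr // mul1r.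
  have -> : star d * z^-1 * d = star (z^-1 * d) * z * (z^-1 * d).
    by rewrite -{1}zd starM frame_index_star !mulrA.
  by rewrite tau_frame_index; apply: sumr_ge0 => i _; exact: tau_sq_ge0.
pose G (s t : 'I_m * 'I_n) := tau (e s.2 * y s.1 t.1 * star (e t.2)).
have G_ge0 u : 0 <= \sum_s \sum_t (u s)^* * G s t * u t.
  have := y_ge0 (fun j => \sum_l u (j, l) *: star (e l)); congr (0 <= _).
  have -> : \sum_s \sum_t (u s)^* * G s t * u t =
      \sum_i \sum_k \sum_j \sum_l (u (i, k))^* * G (i, k) (j, l) * u (j, l).
    rewrite [RHS]pair_bigA; apply: eq_bigr => -[i k] _.
    by rewrite [RHS]pair_bigA; apply: eq_bigr => -[].
  rewrite linear_sum; apply: eq_bigr => i _.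
  rewrite [RHS]exchange_big linear_sum; apply: eq_bigr => j _ /=.
  rewrite star_sum !mulr_suml linear_sum; apply: eq_bigr => k _.
  rewrite mulr_sumr linear_sum; apply: eq_bigr => l _.
  by rewrite starZ starK -![in LHS]scalerAl -[in LHS]scalerAr !tauZ /G /=; ring.
have [X XE] := posform_factor G_ge0.
pose u l i := \sum_k X l (i, k) *: e k.
have yz i j : y i j * z = \sum_l star (u l i) * u l j.
  rewrite mulr_sumr.
  transitivity (\sum_k \sum_k' G (i, k') (j, k) *: (star (e k') * e k)).
    apply: eq_bigr => k _; rewrite mulrA {1}[_ * star _]frame_dual mulr_suml.
    by apply: eq_bigr => k' _; rewrite -scalerAl (tauC tauP) mulrA.
  under eq_bigr => k _ do under eq_bigr => k' _ do rewrite XE scaler_suml.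
  under eq_bigr => k _ do rewrite exchange_big.
  rewrite exchange_big; apply: eq_bigr => l _.
  rewrite star_sum mulr_sumr; apply: eq_bigr => k _.
  rewrite mulr_suml; apply: eq_bigr => k' _.
  by rewrite starZ -scalerAl -scalerAr scalerA.
exists _, (fun l i => w * u l i) => i j.
rewrite -[LHS](mulrK zu) yz mulr_suml; apply: eq_bigr => l _.
have zC x : x * z^-1 = z^-1 * x by apply/commrV/frame_index_central.
by rewrite starM -!mulrA zC wE !mulrA.
Qed.

End Frame.

(** * Completely positive maps *)

Section CompletelyPositive.
Variable R : realType.
Implicit Types A B D : cstarAlgType R.

(** The matrix [T (a_i^* a_j)] is tested against vectors in L^2 rather than
    for being positive over [B]; the two agree by [cp_factor]. *)
Definition completely_positive A B (tau : {scalar B}) (T : A -> B) :=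
  forall m (a : 'I_m -> A) (c : 'I_m -> B),
    0 <= tau (\sum_i \sum_j star (c i) * T (star (a i) * a j) * c j).

Lemma cp_factor A B (tau : {scalar B}) (T : A -> B) m (a : 'I_m -> A) :
    faithful_trace tau -> completely_positive tau T ->
  exists k (v : 'I_k -> 'I_m -> B),
    forall i j, T (star (a i) * a j) = \sum_l star (v l i) * v l j.
Proof.
move=> tauP Tcp; have [n [e eP]] := tau_frame_exists tauP.
exact: (tau_pos_matrix_factor tauP eP (y := fun i j => T (star (a i) * a j))) (Tcp m a).
Qed.

(** By [cp_factor] the matrix [T (a_i^* a_j)] is a sum of matrices
    [v_i^* v_j], against which [T'] may be tested. *)
Lemma cp_comp A B D (tauB : {scalar B}) (tauD : {scalar D})
    (T : A -> B) (T' : {linear B -> D}) :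
    faithful_trace tauB -> completely_positive tauB T ->
  completely_positive tauD T' -> completely_positive tauD (T' \o T).
Proof.
move=> tauBP Tcp T'cp m a c; have [k [v vE]] := cp_factor a tauBP Tcp.
have -> : \sum_i \sum_j star (c i) * (T' \o T) (star (a i) * a j) * c j =
    \sum_l \sum_i \sum_j star (c i) * T' (star (v l i) * v l j) * c j.
  rewrite [RHS]exchange_big; apply: eq_bigr => i _.
  rewrite [RHS]exchange_big; apply: eq_bigr => j _.
  by rewrite /= vE linear_sum mulr_sumr mulr_suml.
by rewrite linear_sum; apply: sumr_ge0 => l _; exact: T'cp.
Qed.

Lemma cp_ext A B (tau : {scalar B}) (T T' : A -> B) :
  T =1 T' -> completely_positive tau T -> completely_positive tau T'.
Proof.
move=> TT Tcp m a c; have := Tcp m a c; congr (0 <= tau _).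
by apply: eq_bigr => i _; apply: eq_bigr => j _; rewrite TT.
Qed.

Lemma cp_add A B (tau : {scalar B}) (T T' : A -> B) :
    completely_positive tau T -> completely_positive tau T' ->
  completely_positive tau (fun x => T x + T' x).
Proof.
move=> Tcp T'cp m a c; have := addr_ge0 (Tcp m a c) (T'cp m a c).
rewrite -linearD; congr (0 <= tau _); rewrite -big_split; apply: eq_bigr => i _.
by rewrite -big_split; apply: eq_bigr => j _; rewrite mulrDr mulrDl.
Qed.

Lemma cp_scale A B (tau : {scalar B}) (T : A -> B) (r : R[i]) :
  0 <= r -> completely_positive tau T -> completely_positive tau (fun x => r *: T x).
Proof.
move=> r_ge0 Tcp m a c; have := mulr_ge0 r_ge0 (Tcp m a c).
rewrite -tauZ; congr (0 <= tau _); rewrite scaler_sumr; apply: eq_bigr => i _.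
rewrite scaler_sumr; apply: eq_bigr => j _.
by rewrite -scalerAr -scalerAl.
Qed.

Lemma cp_compress A B (tau : {scalar B}) (f : A -> B) (g : B) :
    faithful_trace tau -> (forall x y, f (star x * y) = star (f x) * f y) ->
  completely_positive tau (fun x => star g * f x * g).
Proof.
move=> tauP fM m a c.
have -> : \sum_i \sum_j star (c i) * (star g * f (star (a i) * a j) * g) * c j =
    star (\sum_i f (a i) * g * c i) * (\sum_i f (a i) * g * c i).
  rewrite star_sum mulr_suml; apply: eq_bigr => i _.
  by rewrite mulr_sumr; apply: eq_bigr => j _; rewrite fM !starM !mulrA.
exact: tau_sq_ge0.
Qed.

Lemma cp_tau_pos1 A B (tau : {scalar B}) (T : A -> B) :
  completely_positive tau T -> tau_pos tau (T 1).
Proof.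
move=> Tcp d; have := Tcp 1%N (fun=> 1) (fun=> d).
by rewrite !big_ord1 star1 mulr1.
Qed.

End CompletelyPositive.

(** * Comparison of positive operators *)

Section TraceBounds.
Variables (R : realType) (A : cstarAlgType R) (tau : {scalar A}).
Hypothesis tauP : faithful_trace tau.

Definition tau_sqnorm (x : A) := tau (star x * x).

Lemma tau_sqnorm_ge0 x : 0 <= tau_sqnorm x.
Proof. exact: tau_sq_ge0. Qed.

Lemma op_form_CS (T : {linear A -> A}) x y :
    (forall x, 0 <= tau (star x * T x)) ->
  `|tau (star x * T y)| ^+ 2 <= tau (star x * T x) * tau (star y * T y).
Proof.
move=> T_ge0; apply: (@form_CauchySchwarz _ A (fun x y => tau (star x * T y))) => //.
- by move=> u v w; rewrite starD mulrDl linearD.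
- by move=> u v w; rewrite linearD mulrDr linearD.
- by move=> c u v; rewrite starZ -scalerAl tauZ.
- by move=> c u v; rewrite linearZ /= -scalerAr tauZ.
Qed.

Lemma tau_CS x y : `|tau (star x * y)| <= sqrtC (tau_sqnorm x) * sqrtC (tau_sqnorm y).
Proof.
have := @op_form_CS idfun x y tau_sqnorm_ge0 => /= h.
rewrite -ler_sqr ?nnegrE ?mulr_ge0 ?sqrtC_ge0 ?tau_sqnorm_ge0 //.
by rewrite exprMn !sqrtCK.
Qed.

Lemma op_bounded (T : {linear A -> A}) : exists2 c : R[i], 0 <= c &
  forall x, `|tau (star x * T x)| <= c * tau_sqnorm x.
Proof.
have [n [e eP]] := tau_frame_exists tauP.
exists (\sum_i sqrtC (tau_sqnorm (e i)) * sqrtC (tau_sqnorm (T (e i)))) => [|x].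
  by apply: sumr_ge0 => i _; rewrite mulr_ge0 ?sqrtC_ge0 ?tau_sqnorm_ge0.
have -> : tau (star x * T x) =
    \sum_i tau (star (e i) * x) * tau (star x * T (e i)).
  rewrite {2}(eP x) linear_sum mulr_sumr linear_sum; apply: eq_bigr => i _.
  by rewrite linearZ /= -scalerAr tauZ.
apply: le_trans (ler_norm_sum _ _ _) _; rewrite mulr_suml.
apply: ler_sum => i _; rewrite normrM.
have -> : sqrtC (tau_sqnorm (e i)) * sqrtC (tau_sqnorm (T (e i))) * tau_sqnorm x =
   (sqrtC (tau_sqnorm (e i)) * sqrtC (tau_sqnorm x)) *
   (sqrtC (tau_sqnorm x) * sqrtC (tau_sqnorm (T (e i)))).
  by rewrite -{1}[tau_sqnorm x]sqrtCK; ring.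
by apply: ler_pM; rewrite ?tau_CS.
Qed.

Lemma definite_endK (T : 'End(A)) :
    (forall x, tau (star x * T x) = 0 -> x = 0) ->
  forall x, T (T^-1%VF x) = x /\ T^-1%VF (T x) = x.
Proof.
move=> T_inj; apply: injective_endK => x Tx0.
by apply: T_inj; rewrite Tx0 mulr0 linear0.
Qed.

(** Cauchy-Schwarz for the form of [T], at [x = T (T^-1 x)], together with the
    bound of [T^-1]. *)
Lemma op_bounded_below (T : 'End(A)) :
    (forall x, 0 <= tau (star x * T x)) ->
    (forall x, tau (star x * T x) = 0 -> x = 0) ->
  exists2 c : R[i], 0 <= c & forall x, tau_sqnorm x <= c * tau (star x * T x).
Proof.
move=> T_ge0 T_inj; have [c c_ge0 cP] := op_bounded T^-1%VF.
exists c => // x; have [TTx _] := definite_endK T_inj x.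
have := tau_sqnorm_ge0 x; rewrite le0r => /orP[/eqP->|x_gt0]; first by rewrite mulr_ge0.
have := op_form_CS x (T^-1%VF x) T_ge0; rewrite /= TTx -/(tau_sqnorm x).
rewrite ger0_norm ?tau_sqnorm_ge0 // => h.
rewrite -(ler_pM2r x_gt0) -expr2 (le_trans h) // -mulrA mulrCA ler_wpM2l //.
have := cP x; rewrite (tau_form_herm tauP) norm_conjC ger0_norm //.
by have := T_ge0 (T^-1%VF x); rewrite TTx.
Qed.

End TraceBounds.

(** * Complete positivity of the inverse of [x |-> k x + x k - Psi x] *)

Lemma complex_archimedean (R : realType) (z : R[i]) :
  0 <= z -> exists n : nat, z < n%:R.
Proof.
move=> z_ge0; exists (Num.bound (complex.Re z)).
rewrite -[X in X < _]RRe_real ?ger0_real // -(rmorph_nat (@real_complex R)) ltcR.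
by apply: archi_boundP; move: z_ge0; rewrite lecE => /andP[].
Qed.

Lemma le_geometric_eq0 (R : realType) (eps c h : R[i]) :
    0 <= eps -> 0 <= c -> 0 < h -> h <= 1 ->
    (forall N : nat, eps <= c * (1 - h) ^+ N) -> eps = 0.
Proof.
move=> eps_ge0 c_ge0 h_gt0 h_le1 epsP.
(* Bernoulli's inequality, in a form that avoids inverting 1 - h. *)
have bern N : (1 - h) ^+ N * (1 + N%:R * h) <= 1.
  elim: N => [|N IHN]; first by rewrite expr0 mul0r addr0 mulr1.
  apply: le_trans IHN; rewrite exprSr -mulrA ler_wpM2l ?exprn_ge0 ?subr_ge0 //.
  rewrite -subr_ge0 (_ : _ - _ = N.+1%:R * h ^+ 2); last by rewrite -addn1 natrD; ring.
  by rewrite mulr_ge0 ?ler0n ?exprn_ge0 ?ltW.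
apply/eqP; move: eps_ge0; rewrite le0r => /orP[//|eps_gt0].
have [N] := complex_archimedean (divr_ge0 c_ge0 (ltW (mulr_gt0 eps_gt0 h_gt0))).
rewrite ltr_pdivrMr ?mulr_gt0 // => lt_c.
have : eps * (1 + N%:R * h) <= c.
  apply: le_trans (_ : c * ((1 - h) ^+ N * (1 + N%:R * h)) <= _).
    by rewrite mulrA ler_wpM2r // addr_ge0 // mulr_ge0 ?ler0n ?ltW.
  by rewrite -[X in _ <= X]mulr1 ler_wpM2l.
rewrite mulrDr mulr1 => /(lt_le_trans (_ : c < _)) H.
have : c < c by apply: H; rewrite (lt_le_trans lt_c) // mulrCA lerDr ltW.
by rewrite ltxx.
Qed.

(** The positive complex numbers form a closed set; closedness is used through
    the distance from [q] to [`|q|]. *)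
Lemma ge0_geometric_limit (R : realType) (q c h : R[i]) (p f : nat -> R[i]) :
    0 <= c -> 0 < h -> h <= 1 -> (forall N, 0 <= p N) ->
    (forall N, q = p N + f N) -> (forall N, `|f N| <= c * (1 - h) ^+ N) ->
  0 <= q.
Proof.
move=> c_ge0 h_gt0 h_le1 p_ge0 qE f_le.
suff /eqP : `|q - `|q| | = 0 by rewrite normr_eq0 subr_eq0 => /eqP ->.
apply: (@le_geometric_eq0 _ _ (2 * c) h) => // [|N]; first by rewrite mulr_ge0.
have -> : q - `|q| = f N + (`|p N| - `|q|).
  by rewrite (ger0_norm (p_ge0 N)) {1}(qE N); ring.
apply: le_trans (ler_normD _ _) _.
have -> : 2 * c * (1 - h) ^+ N = c * (1 - h) ^+ N + c * (1 - h) ^+ N by ring.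
apply: lerD => //; apply: le_trans (f_le N).
apply: le_trans (ler_dist_dist _ _) _.
by rewrite [X in _ - X](qE N) opprD addNKr normrN.
Qed.

Section InverseCP.
Variables (R : realType) (A : cstarAlgType R) (tau : {scalar A}).
Hypothesis tauP : faithful_trace tau.

Local Notation sq := (tau_sqnorm tau).
Local Notation form T x := (tau (star x * T x)).

(** If [V] is at most [r U] as a form, then [U^-1 V] contracts the norm of
    [U] by the factor [r]. *)
Lemma dominated_contraction (U Ui V : 'End(A)) (r : R[i]) (x : A) :
    (forall y, U (Ui y) = y) -> 0 <= r ->
    (forall y, 0 <= form U y) -> (forall y, 0 <= form V y) ->
    (forall y, form V y <= r * form U y) ->
  form U (Ui (V x)) <= r ^+ 2 * form U x.
Proof.
move=> UUi r_ge0 U_ge0 V_ge0 V_le; set w := Ui (V x).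
have := U_ge0 w; rewrite le0r => /orP[/eqP ->|w_gt0].
  by rewrite mulr_ge0 ?exprn_ge0.
(* form U w = <w, V x>, to which Cauchy-Schwarz for the form of V applies. *)
have wE : form U w = tau (star w * V x) by rewrite {2}/w UUi.
rewrite -(ler_pM2r w_gt0) -expr2.
have := op_form_CS w x V_ge0; rewrite /= -wE ger0_norm // => /le_trans -> //.
rewrite (_ : _ * form U x * _ = (r * form U w) * (r * form U x)); last by ring.
by apply: ler_pM.
Qed.

(** [Z = (U - V)^-1] is the sum of the Neumann series with terms
    [(U^-1 V)^N U^-1], each of which is completely positive. *)
Lemma cp_dominated_inverse (U Ui V Z : 'End(A)) (d h : R[i]) :
    (forall x, U (Ui x) = x) -> (forall x, Ui (U x) = x) ->
    completely_positive tau Ui -> completely_positive tau V ->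
    0 < d -> (forall x, d ^+ 2 * sq x <= form U x) -> (forall x, 0 <= form V x) ->
    0 < h -> h <= 1 -> (forall x, form V x <= (1 - h) * form U x) ->
    (forall x, U (Z x) - V (Z x) = x) ->
  completely_positive tau Z.
Proof.
move=> UUi UiU Ui_cp V_cp d_gt0 U_ge V_ge0 h_gt0 h_le1 V_le UVZ.
have d_ge0 := ltW d_gt0.
have rho_ge0 : 0 <= 1 - h by rewrite subr_ge0.
have U_ge0 x : 0 <= form U x.
  by apply: le_trans (U_ge x); rewrite mulr_ge0 ?exprn_ge0 ?tau_sqnorm_ge0.
pose W := (Ui \o V)%VF.
have WE x : W x = Ui (V x) by rewrite comp_lfunE.
have U_iter N x : form U (iter N W x) <= ((1 - h) ^+ N) ^+ 2 * form U x.
  elim: N => [|N IHN]; first by rewrite expr0 expr1n mul1r.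
  rewrite iterS WE (le_trans (dominated_contraction _ UUi _ _ _ V_le)) //.
  by rewrite (exprS _ N) exprMn -[leRHS]mulrA ler_wpM2l ?exprn_ge0.
have W_cp : completely_positive tau W.
  apply: (@cp_ext _ _ _ _ (fun x => Ui (V x))) => [x|]; first by rewrite WE.
  exact: (cp_comp (T := V) (T' := Ui) tauP V_cp Ui_cp).
(* T N is the N-th partial sum of the Neumann series of Z, and W^N Z its tail. *)
pose T N x := iter N (fun y => Ui x + W y) 0.
have T_cp N : completely_positive tau (T N).
  elim: N => [|N IHN] /=.
    move=> m a c; rewrite !big1 ?linear0 // => i _.
    by rewrite big1 // => j _; rewrite mulr0 mul0r.
  by apply: cp_add => //; exact: (cp_comp (T := T N) (T' := W) tauP IHN W_cp).
have ZT N x : Z x = T N x + iter N W (Z x).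
  elim: N => [|N IHN]; first by rewrite add0r.
  rewrite iterS /= -addrA -linearD -IHN /= WE -{2}[x]UVZ.
  by rewrite -linearD /= subrK UiU.
move=> m y c; pose Zy i j := Z (star (y i) * y j).
pose f N := \sum_i \sum_j tau (star (c i) * iter N W (Zy i j) * c j).
pose p N := tau (\sum_i \sum_j star (c i) * T N (star (y i) * y j) * c j).
pose K := \sum_i \sum_j sqrtC (sq (c i * star (c j))) * (sqrtC (form U (Zy i j)) / d).
have sqr_ge0 x : 0 <= sqrtC (sq x) by rewrite sqrtC_ge0 tau_sqnorm_ge0.
have K_ge0 : 0 <= K.
  apply: sumr_ge0 => i _; apply: sumr_ge0 => j _.
  by rewrite mulr_ge0 // divr_ge0 // sqrtC_ge0.
apply: (@ge0_geometric_limit _ _ K h p f) => // [N|N|N].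
- exact: T_cp.
- rewrite /p /f !linear_sum -big_split; apply: eq_bigr => i _ /=.
  rewrite !linear_sum -big_split; apply: eq_bigr => j _ /=.
  by rewrite -tauD -mulrDl -mulrDr -ZT.
apply: le_trans (ler_norm_sum _ _ _) _; rewrite mulr_suml; apply: ler_sum => i _.
apply: le_trans (ler_norm_sum _ _ _) _; rewrite mulr_suml; apply: ler_sum => j _.
rewrite (tauC tauP) mulrA -[c j]starK -starM.
apply: le_trans (tau_CS tauP _ _) _; rewrite starK -mulrA ler_wpM2l //.
rewrite mulrAC ler_pdivlMr // mulrC.
rewrite -ler_sqr ?nnegrE ?mulr_ge0 ?exprn_ge0 ?sqrtC_ge0 ?tau_sqnorm_ge0 //.
rewrite !exprMn !sqrtCK (le_trans (U_ge _)) // mulrC; exact: U_iter.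
Qed.

(** The identity [2 s (k x + x k) = (k + s) x (k + s) - (k - s) x (k - s)]
    exhibits [2 s S] as the difference [U - V] of a map with completely
    positive inverse and a completely positive map. *)
Lemma inverse_cp (k : A) (Psi S : 'End(A)) :
    tau_pos tau k -> completely_positive tau Psi ->
    (forall x, S x = k * x + x * k - Psi x) ->
    (forall x, 0 <= form S x) -> (forall x, form S x = 0 -> x = 0) ->
  completely_positive tau (S^-1)%VF.
Proof.
move=> k_pos Psi_cp SE S_ge0 S_inj.
have [c0 c0_ge0 S_le] := op_bounded tauP S.
have [c2 c2_ge0 S_geN] := op_bounded_below tauP S_ge0 S_inj.
(* The shift s makes k + s invertible, and s >= 2 c0 makes V below positive. *)
pose s := 2 * c0 + 1; have s_gt0 : 0 < s by rewrite ltr_wpDl // mulr_ge0.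
have s_ge0 := ltW s_gt0; have [n [e eP]] := tau_frame_exists tauP.
have [w kE] := tau_pos_nonneg tauP eP k_pos.
have k_star : star k = k by rewrite kE starM starK.
have s_star : star (s%:A : A) = s%:A.
  by rewrite starZ star1 (CrealP _) // ger0_real // ltW.
pose a := k + s%:A.
have a_star : star a = a by rewrite starD s_star k_star.
have sA (x : A) : s%:A * x = s *: x by rewrite -scalerAl mul1r.
have As (x : A) : x * s%:A = s *: x by rewrite -scalerAr mulr1.
have tau_kx x : 0 <= tau (star x * (k * x)) by rewrite mulrA; exact: k_pos.
have tau_xk x : 0 <= tau (star x * (x * k)).
  have := tau_sq_ge0 tauP (x * star w); congr (0 <= _).
  by rewrite starM starK kE -mulrA (tauC tauP) !mulrA.
have tau_kxk x : 0 <= tau (star x * (k * x * k)).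
  have := tau_sq_ge0 tauP (w * x * star w); congr (0 <= _).
  by rewrite !starM starK kE -!mulrA (tauC tauP) -!mulrA.
have au : a \is a GRing.unit.
  apply: unit_of_injective => x ax0; apply: (tau_sq_eq0 tauP).
  have := congr1 (fun y => tau (star x * y)) ax0.
  rewrite mulr0 linear0 mulrDl sA mulrDr linearD -scalerAr tauZ => /eqP.
  rewrite paddr_eq0 ?tau_kx ?mulr_ge0 ?tau_sq_ge0 ?s_ge0 //.
  by rewrite mulf_eq0 (gt_eqF s_gt0) /= => /andP[_ /eqP].
pose g := a^-1; have ag : a * g = 1 := divrr au; have ga : g * a = 1 := mulVr au.
have g_star : star g = g.
  by apply: (mulrI au); rewrite ag -{1}a_star -starM ga star1.
pose U := (amull a \o amulr a)%VF; pose b := k - s%:A.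
have UE x : U x = a * (x * a) by rewrite comp_lfunE !lfunE.
pose Ui := (amull g \o amulr g)%VF.
have UiE x : Ui x = g * x * g by rewrite comp_lfunE !lfunE /= mulrA.
have UUi x : U (Ui x) = x by rewrite UE UiE -!mulrA ga mulr1 mulrA ag mul1r.
have UiU x : Ui (U x) = x by rewrite UE UiE -!mulrA ag mulr1 mulrA ga mul1r.
pose V := ((amull b \o amulr b) + 2 * s *: Psi)%VF.
have VE x : V x = b * x * b + 2 * s *: Psi x.
  by rewrite add_lfunE scale_lfunE comp_lfunE !lfunE /= mulrA.
have UX x : U x = k * x * k + s ^+ 2 *: x + s *: (k * x + x * k).
  rewrite UE /a mulrDl !mulrDr !As !sA -scalerAr scalerA -expr2 mulrA scalerDr.
  by rewrite -!addrA; congr (_ + _); rewrite addrA addrC.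
have VX x : V x = k * x * k + s ^+ 2 *: x - s *: (k * x + x * k) + 2 * s *: Psi x.
  rewrite VE; congr (_ + _).
  rewrite /b mulrBr mulrBl As sA mulrBl -scalerAl scalerBr scalerA -expr2 scalerDr.
  by rewrite opprB opprD !addrA [RHS]addrAC; congr (_ + _); rewrite addrAC.
have UVS x : U x - V x = 2 * s *: S x.
  rewrite UX VX SE opprD addrA opprD opprK addrA [X in X - _ + _ - _]addrC addrK.
  by rewrite scalerBr; congr (_ - _); rewrite -scalerDl; congr (_ *: _); ring.
have UfE x : form U x = tau (star x * (k * x * k)) + s ^+ 2 * sq x +
    s * (tau (star x * (k * x)) + tau (star x * (x * k))).
  by rewrite UX 2!mulrDr -!scalerAr mulrDr !tauD !tauZ tauD.
have U_ge x : s ^+ 2 * sq x <= form U x.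
  rewrite UfE -addrA addrCA lerDl addr_ge0 ?tau_kxk // mulr_ge0 // addr_ge0 //.
have U_ge0 x : 0 <= form U x.
  by apply: le_trans (U_ge x); rewrite mulr_ge0 ?exprn_ge0 ?tau_sqnorm_ge0.
have VfE x : form V x = form U x - 2 * s * form S x.
  rewrite (_ : V x = U x - 2 * s *: S x) ?mulrBr ?tauB -?scalerAr ?tauZ //.
  by rewrite -UVS subKr.
have V_ge0 x : 0 <= form V x.
  rewrite VfE subr_ge0 (le_trans _ (U_ge x)) // expr2 [2 * s]mulrC -!mulrA ler_wpM2l //.
  apply: le_trans (_ : 2 * (c0 * sq x) <= _).
    by rewrite ler_wpM2l // (le_trans _ (S_le x)) // ger0_norm.
  by rewrite mulrA ler_wpM2r ?tau_sqnorm_ge0 // lerDl.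
have b_star : star b = b by rewrite starD starN s_star k_star.
have V_cp : completely_positive tau V.
  apply: (@cp_ext _ _ _ _ (fun x => star b * x * b + 2 * s *: Psi x)) => [x|].
    by rewrite VE b_star.
  apply: cp_add; last by apply: cp_scale => //; rewrite mulr_ge0.
  exact: (cp_compress (f := id)).
have Ui_cp : completely_positive tau Ui.
  apply: (@cp_ext _ _ _ _ (fun x => star g * x * g)) => [x|].
    by rewrite UiE g_star.
  exact: (cp_compress (f := id)).
have [c1 c1_ge0 U_le] := op_bounded tauP U.
(* form U <= c1 sq <= c1 c2 form S, hence form U <= M (2 s form S). *)
pose M := c1 * c2 / (2 * s) + 1; pose h := M^-1.
have M_ge1 : 1 <= M by rewrite lerDr divr_ge0 ?mulr_ge0.
have M_gt0 : 0 < M by apply: lt_le_trans M_ge1.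
have h_gt0 : 0 < h by rewrite invr_gt0.
have h_le1 : h <= 1 by rewrite invf_le1.
have V_le x : form V x <= (1 - h) * form U x.
  rewrite VfE mulrBl mul1r lerD2l lerN2 /h mulrC ler_pdivrMr //.
  have -> : 2 * s * form S x * M = c1 * (c2 * form S x) + 2 * s * form S x.
    by rewrite /M; field; rewrite gt_eqF.
  rewrite ler_wpDr ?mulr_ge0 //; apply: le_trans (_ : c1 * sq x <= _).
    by apply: le_trans (U_le x); rewrite /= ger0_norm.
  by rewrite ler_wpM2l.
have s2_neq0 : 2 * s != 0 by rewrite mulf_neq0 ?pnatr_eq0 ?gt_eqF.
pose Z : 'End(A) := (2 * s)^-1 *: (S^-1)%VF.
have ZE x : Z x = (2 * s)^-1 *: (S^-1)%VF x by rewrite scale_lfunE.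
have Z_cp : completely_positive tau Z.
  apply: (cp_dominated_inverse UUi UiU Ui_cp V_cp s_gt0 U_ge V_ge0 h_gt0 h_le1 V_le) => x.
  have [SSx _] := definite_endK S_inj x.
  by rewrite UVS ZE linearZ /= SSx scalerA divff // scale1r.
apply: (@cp_ext _ _ _ _ (fun x => 2 * s *: Z x)) => [x|].
  by rewrite ZE scalerA divff // scale1r.
by apply: cp_scale => //; rewrite mulr_ge0.
Qed.

End InverseCP.

(** * The metric of a completely positive map *)

Section CPMetric.
Variables (R : realType) (A : cstarAlgType R) (tau : {scalar A}).
Hypothesis tauP : faithful_trace tau.
Variables (n : nat) (e : 'I_n -> A).
Hypothesis eP : forall x, x = \sum_i tau (star (e i) * x) *: e i.
Variable Phi : 'End(A).
Hypothesis Phi_cp : completely_positive tau Phi.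

Lemma cp_star x : star (Phi x) = Phi (star x).
Proof.
pose a (i : 'I_2) : A := if i == 0 then 1 else x.
have [k [v vE]] := cp_factor a tauP Phi_cp.
have := vE 0 1; have := vE 1 0; rewrite /a /= star1 mul1r mulr1 => -> ->.
by rewrite star_sum; apply: eq_bigr => l _; rewrite starM starK.
Qed.

(** The bimodule of the Stinespring dilation of [Phi], with cyclic vector
    [xi], embeds into the linear endomorphisms by sending [v] to
    [x |-> <x^* xi, v>].  This map takes [xi] to [Phi] and the actions to the
    following ones, so that no quotient by null vectors has to be formed. *)
Definition end_lact (a : A) (L : 'End(A)) : 'End(A) := (L \o amulr a)%VF.
Definition end_ract (L : 'End(A)) (a : A) : 'End(A) := (amulr a \o L)%VF.

Lemma end_lactE a L x : end_lact a L x = L (x * a).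
Proof. by rewrite comp_lfunE lfunE. Qed.
Lemma end_ractE a L x : end_ract L a x = L x * a.
Proof. by rewrite comp_lfunE lfunE. Qed.

Definition commutator_form (b : A) : 'End(A) := end_lact b Phi - end_ract Phi b.

Lemma commutator_formE b x : commutator_form b x = Phi (x * b) - Phi x * b.
Proof. by rewrite add_lfunE opp_lfunE end_lactE end_ractE. Qed.

Lemma commutator_form_linear : linear commutator_form.
Proof.
move=> c x y; apply/lfunP => z.
rewrite [RHS]add_lfunE scale_lfunE !commutator_formE mulrDr -scalerAr linearP.
by rewrite mulrDr -scalerAr opprD addrACA scalerBr.
Qed.
HB.instance Definition _ := GRing.isLinear.Build R[i] A 'End(A) _
  commutator_form commutator_form_linear.

(** Since the [e_i] span [A], the vectors [sum_i e_i Phi v_i] exhaust the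
    bimodule generated by [Phi]; likewise for the forms
    [sum_i e_i (d v_i)]. *)
Definition gns_vector (v : {ffun 'I_n -> A}) : 'End(A) :=
  \sum_i end_ract (end_lact (e i) Phi) (v i).
Definition diff_form (v : {ffun 'I_n -> A}) : 'End(A) :=
  \sum_i end_lact (e i) (commutator_form (v i)).

Lemma gns_vectorE v x : gns_vector v x = \sum_i Phi (x * e i) * v i.
Proof. by rewrite sum_lfunE; apply: eq_bigr => i _; rewrite end_ractE end_lactE. Qed.
Lemma diff_formE v x :
  diff_form v x = \sum_i commutator_form (v i) (x * e i).
Proof. by rewrite sum_lfunE; apply: eq_bigr => i _; rewrite end_lactE. Qed.

Lemma gns_vector_linear : linear gns_vector.
Proof.
move=> c u v; apply/lfunP => x; rewrite add_lfunE scale_lfunE !gns_vectorE.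
rewrite scaler_sumr -big_split; apply: eq_bigr => i _.
by rewrite !ffunE mulrDr scalerAr.
Qed.
Lemma diff_form_linear : linear diff_form.
Proof.
move=> c u v; apply/lfunP => x; rewrite add_lfunE scale_lfunE !diff_formE.
rewrite scaler_sumr -big_split; apply: eq_bigr => i _.
by rewrite !ffunE linearP add_lfunE scale_lfunE.
Qed.
HB.instance Definition _ := GRing.isLinear.Build R[i] {ffun 'I_n -> A} 'End(A) _
  gns_vector gns_vector_linear.
HB.instance Definition _ := GRing.isLinear.Build R[i] {ffun 'I_n -> A} 'End(A) _
  diff_form diff_form_linear.

Definition gns_space : {vspace 'End(A)} := limg (linfun gns_vector).
Definition form_space : {vspace 'End(A)} := limg (linfun diff_form).

Lemma memv_gns (L : 'End(A)) m (a c : 'I_m -> A) :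
  (forall x, L x = \sum_k Phi (x * a k) * c k) -> L \in gns_space.
Proof.
move=> LE; have -> : L = \sum_k end_ract (end_lact (a k) Phi) (c k).
  apply/lfunP => x; rewrite sum_lfunE LE; apply: eq_bigr => k _.
  by rewrite end_ractE end_lactE.
apply: memv_suml => k _; apply/memv_imgP.
exists [ffun i => tau (star (e i) * a k) *: c k]; first exact: memvf.
rewrite lfunE /=; apply/lfunP => x; rewrite gns_vectorE end_ractE end_lactE.
rewrite {1}(eP (a k)) mulr_sumr linear_sum mulr_suml; apply: eq_bigr => i _.
by rewrite ffunE -scalerAr linearZ -scalerAl scalerAr.
Qed.

Lemma memv_lact_commutator a b : end_lact a (commutator_form b) \in form_space.
Proof.
apply/memv_imgP; exists [ffun i => tau (star (e i) * a) *: b]; first exact: memvf.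
rewrite lfunE /=; apply/lfunP => x; rewrite diff_formE end_lactE.
rewrite {1}(eP a) mulr_sumr linear_sum; apply: eq_bigr => i _.
by rewrite ffunE linearZ /= scale_lfunE -scalerAr linearZ.
Qed.

Lemma memv_commutator b : commutator_form b \in form_space.
Proof.
have -> : commutator_form b = end_lact 1 (commutator_form b).
  by apply/lfunP => x; rewrite end_lactE mulr1.
exact: memv_lact_commutator.
Qed.

Lemma form_spaceP L : L \in form_space ->
  exists v : 'I_n -> A, L = \sum_i end_lact (e i) (commutator_form (v i)).
Proof. by move=> /memv_imgP[v _ ->]; exists v; rewrite lfunE. Qed.

Lemma memv_lact a L : L \in form_space -> end_lact a L \in form_space.
Proof.
move=> /form_spaceP[v ->].
have -> : end_lact a (\sum_i end_lact (e i) (commutator_form (v i))) =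
    \sum_i end_lact (a * e i) (commutator_form (v i)).
  apply/lfunP => x; rewrite end_lactE !sum_lfunE; apply: eq_bigr => i _.
  by rewrite !end_lactE mulrA.
by apply: memv_suml => i _; exact: memv_lact_commutator.
Qed.

(** [(e d v) a = e d (v a) - (e v) d a] by the Leibniz rule. *)
Lemma memv_ract a L : L \in form_space -> end_ract L a \in form_space.
Proof.
move=> /form_spaceP[v ->].
have -> : end_ract (\sum_i end_lact (e i) (commutator_form (v i))) a =
    \sum_i (end_lact (e i) (commutator_form (v i * a)) -
            end_lact (e i * v i) (commutator_form a)).
  apply/lfunP => x; rewrite end_ractE !sum_lfunE mulr_suml; apply: eq_bigr => i _.
  rewrite add_lfunE opp_lfunE !end_lactE !commutator_formE mulrBl !mulrA opprB.
  by rewrite [RHS]addrA [RHS]addrAC [X in _ = X + _]addrAC subrr sub0r addrC.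
by apply: memv_suml => i _; rewrite memvB ?memv_lact_commutator.
Qed.

Lemma form_space_sub_gns L : L \in form_space -> L \in gns_space.
Proof.
move=> /form_spaceP[v ->]; apply: memv_suml => i _.
apply: (@memv_gns _ 2 (fun k => if k == 0 then e i * v i else e i)
                      (fun k => if k == 0 then 1 else - v i)) => x.
rewrite end_lactE commutator_formE !big_ord_recl big_ord0 /= addr0 mulr1 mulrN.
by rewrite mulrA.
Qed.

Definition gns_coef (L : 'End(A)) : {ffun 'I_n -> A} := (linfun gns_vector)^-1%VF L.

Lemma gns_coefE (L : 'End(A)) x : L \in gns_space ->
  L x = \sum_i Phi (x * e i) * gns_coef L i.
Proof.
by move=> Lin; rewrite -gns_vectorE -{1}(limg_lfunVK Lin) lfunE.
Qed.

(** [<sum_i e_i Phi v_i, L> = sum_i v_i^* L (star e_i)]: evaluating an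
    endomorphism at [star e_i] is pairing it with [e_i Phi]. *)
Definition gns_ip (L' L : 'End(A)) : A :=
  \sum_i star (gns_coef L' i) * L (star (e i)).

Lemma gns_ip_coef L' L : L \in gns_space ->
  gns_ip L' L =
  \sum_i \sum_j star (gns_coef L' i) * Phi (star (e i) * e j) * gns_coef L j.
Proof.
move=> Lin; apply: eq_bigr => i _; rewrite (gns_coefE _ Lin) mulr_sumr.
by apply: eq_bigr => j _; rewrite mulrA.
Qed.

Lemma gns_ip_star L' L : L' \in gns_space -> L \in gns_space ->
  star (gns_ip L' L) = gns_ip L L'.
Proof.
move=> L'in Lin; rewrite !gns_ip_coef // star_sum.
under eq_bigr do rewrite star_sum.
rewrite exchange_big; apply: eq_bigr => i _; apply: eq_bigr => j _.
by rewrite !starM starK cp_star starM starK mulrA.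
Qed.

(** By definition [<L, L'>] depends on [L'] only through its values, so by
    symmetry [<L', L>] can be computed from any expansion of [L']. *)
Lemma gns_ipE (L' L : 'End(A)) m (a c : 'I_m -> A) : L \in gns_space ->
    (forall x, L' x = \sum_k Phi (x * a k) * c k) ->
  gns_ip L' L = \sum_k star (c k) * L (star (a k)).
Proof.
move=> Lin L'E; rewrite -gns_ip_star ?(memv_gns L'E) // star_sum.
under eq_bigr => i _ do rewrite starM starK L'E star_sum mulr_suml.
rewrite exchange_big; apply: eq_bigr => k _; rewrite (gns_coefE _ Lin) mulr_sumr.
by apply: eq_bigr => j _; rewrite starM cp_star starM starK mulrA.
Qed.

Lemma gns_ip_ge0 L : L \in gns_space -> cstar_nonneg (gns_ip L L).
Proof.
move=> Lin; apply: (tau_pos_nonneg tauP eP) => d.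
have := Phi_cp e (fun i => gns_coef L i * d); congr (0 <= tau _).
rewrite gns_ip_coef // mulr_sumr mulr_suml; apply: eq_bigr => i _.
rewrite mulr_sumr mulr_suml; apply: eq_bigr => j _.
by rewrite starM !mulrA.
Qed.

(** Factoring [Phi (e_i^* e_j)] as [sum_l v_li^* v_lj] makes [<L, L>] a sum of
    squares [u_l^* u_l] and [L (star e_i)] a combination of the [u_l]. *)
Lemma gns_ip_eq0 L : L \in gns_space -> gns_ip L L = 0 -> L = 0.
Proof.
move=> Lin; have [k [v vE]] := cp_factor e tauP Phi_cp.
pose u l := \sum_j v l j * gns_coef L j.
have -> : gns_ip L L = \sum_l star (u l) * u l.
  rewrite gns_ip_coef //.
  under eq_bigr => i _ do under eq_bigr => j _ do rewrite vE mulr_sumr mulr_suml.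
  under eq_bigr => i _ do rewrite exchange_big.
  rewrite exchange_big; apply: eq_bigr => l _.
  rewrite star_sum mulr_suml; apply: eq_bigr => i _.
  by rewrite mulr_sumr; apply: eq_bigr => j _; rewrite starM !mulrA.
move=> /(congr1 tau); rewrite linear0 linear_sum => /eqP.
rewrite psumr_eq0 => [/allP u0|l _]; last exact: tau_sq_ge0.
have {}u0 l : u l = 0 by apply: (tau_sq_eq0 tauP); apply/eqP/u0; rewrite mem_index_enum.
have L0 i : L (star (e i)) = 0.
  rewrite (gns_coefE _ Lin).
  under eq_bigr => j _ do rewrite vE mulr_suml.
  rewrite exchange_big big1 // => l _.
  transitivity (star (v l i) * u l); last by rewrite u0 mulr0.
  by rewrite mulr_sumr; apply: eq_bigr => j _; rewrite mulrA.
apply/lfunP => x; rewrite zero_lfunE (frame_dual tauP eP x) linear_sum big1 // => i _.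
by rewrite linearZ /= L0 scaler0.
Qed.

Definition form_lact (a : A) (w : subvs_of form_space) : subvs_of form_space :=
  vsproj form_space (end_lact a (vsval w)).
Definition form_ract (w : subvs_of form_space) (a : A) : subvs_of form_space :=
  vsproj form_space (end_ract (vsval w) a).
Definition form_d (b : A) : subvs_of form_space :=
  vsproj form_space (commutator_form b).

Lemma form_lactE a w x : vsval (form_lact a w) x = vsval w (x * a).
Proof. by rewrite vsprojK ?memv_lact ?subvsP // end_lactE. Qed.
Lemma form_ractE a w x : vsval (form_ract w a) x = vsval w x * a.
Proof. by rewrite vsprojK ?memv_ract ?subvsP // end_ractE. Qed.
Lemma form_dE b : vsval (form_d b) = commutator_form b.
Proof. by rewrite vsprojK ?memv_commutator. Qed.

Lemma form_d_linear : linear form_d.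
Proof. by move=> c x y; rewrite /form_d !linearP. Qed.
HB.instance Definition _ := GRing.isLinear.Build R[i] A (subvs_of form_space) _
  form_d form_d_linear.

Lemma form_eq (v w : subvs_of form_space) :
  (forall x, vsval v x = vsval w x) -> v = w.
Proof. by move=> vw; apply: val_inj; apply/lfunP. Qed.

Definition form_bimodule : bimodule A.
Proof.
apply: (@Bimodule R A (subvs_of form_space) form_lact form_ract).
- by move=> w; apply: form_eq => x; rewrite form_lactE mulr1.
- by move=> w; apply: form_eq => x; rewrite form_ractE mulr1.
- by move=> a b w; apply: form_eq => x; rewrite !form_lactE mulrA.
- by move=> a b w; apply: form_eq => x; rewrite !form_ractE mulrA.
- by move=> a b w; apply: form_eq => x; rewrite !(form_lactE, form_ractE).
- move=> a b w; apply: form_eq => x.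
  by rewrite form_lactE linearD add_lfunE !form_lactE mulrDr linearD.
- move=> a v w; apply: form_eq => x.
  by rewrite form_lactE !linearD !add_lfunE !form_lactE.
- move=> v w a; apply: form_eq => x.
  by rewrite form_ractE !linearD !add_lfunE !form_ractE mulrDl.
- move=> w a b; apply: form_eq => x.
  by rewrite form_ractE linearD add_lfunE !form_ractE mulrDr.
- move=> c w; apply: form_eq => x.
  by rewrite form_lactE linearZ scale_lfunE -scalerAr mulr1 linearZ.
- move=> c w; apply: form_eq => x.
  by rewrite form_ractE linearZ scale_lfunE -scalerAr mulr1.
Defined.

Definition form_ip (v w : form_bimodule) : A := gns_ip (vsval v) (vsval w).

Lemma form_gns (w : subvs_of form_space) : vsval w \in gns_space.
Proof. exact/form_space_sub_gns/subvsP. Qed.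

Definition cp_metric : riem_metric A.
Proof.
apply: (@RiemMetric R A form_bimodule form_d form_ip).
- move=> a b; apply: form_eq => x.
  rewrite linearD add_lfunE form_ractE form_lactE !form_dE !commutator_formE.
  by rewrite mulrBl !mulrA [RHS]addrC [RHS]addrA subrK.
- move=> S [S0 SD Sl _] Sd w.
  have [v wE] := form_spaceP (subvsP w).
  have -> : w = \sum_i form_lact (e i) (form_d (v i)).
    apply: form_eq => x; rewrite wE linear_sum !sum_lfunE; apply: eq_bigr => i _.
    by rewrite form_lactE form_dE end_lactE.
  elim/big_rec: _ => // i y _ Sy; apply: SD => //; apply: Sl.
  by apply: Sd; exists (v i).
- move=> u v w; rewrite /form_ip /gns_ip linearD -big_split; apply: eq_bigr => i _ /=.
  by rewrite /gns_coef linearD ffunE starD mulrDl.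
- move=> u v w; rewrite /form_ip /gns_ip linearD -big_split; apply: eq_bigr => i _ /=.
  by rewrite add_lfunE mulrDr.
- move=> c v w; rewrite /form_ip /gns_ip linearZ scaler_sumr; apply: eq_bigr => i _ /=.
  by rewrite /gns_coef linearZ ffunE starZ scalerAl.
- move=> c v w; rewrite /form_ip /gns_ip linearZ scaler_sumr; apply: eq_bigr => i _ /=.
  by rewrite scale_lfunE scalerAr.
- move=> v w a; rewrite /form_ip /gns_ip mulr_suml; apply: eq_bigr => i _.
  by rewrite form_ractE mulrA.
- by move=> v w; apply: gns_ip_star; exact: form_gns.
- move=> a v w; rewrite /form_ip.
  rewrite (gns_ipE (a := fun i => a * e i) (c := gns_coef (vsval v))) ?form_gns //.
    by apply: eq_bigr => i _; rewrite form_lactE starM.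
  move=> x; rewrite form_lactE gns_coefE ?form_gns //.
    by apply: eq_bigr => i _; rewrite mulrA.
- by move=> w; apply: gns_ip_ge0; exact: form_gns.
- move=> w /(gns_ip_eq0 (form_gns w)) w0; apply: form_eq => x.
  by rewrite w0 linear0.
Defined.

Lemma cp_metric_cdc a b : cdc cp_metric a b =
  Phi (star a * b) - Phi (star a) * b - star a * Phi b + star a * Phi 1 * b.
Proof.
rewrite /cdc /= /form_ip.
rewrite (gns_ipE (m := 2) (a := fun k => if k == 0 then a else 1)
                 (c := fun k => if k == 0 then 1 else - a)) ?form_gns //; last first.
  move=> x; rewrite form_dE commutator_formE !big_ord_recl big_ord0 /= addr0.
  by rewrite !mulr1 mulrN.
rewrite !big_ord_recl big_ord0 /= addr0 form_dE !commutator_formE star1 starN.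
by rewrite !mul1r mulNr mulrBr opprB !mulrA addrA addrAC.
Qed.

End CPMetric.

(** * Every metric comes from a completely positive map *)

Lemma linear_hom (F : fieldType) (U V : vectType F) (f : U -> V) :
  linear f -> exists g : 'Hom(U, V), forall x, g x = f x.
Proof.
move=> f_lin; pose f' : {linear U -> V} :=
  HB.pack f (GRing.isLinear.Build F U V _ f f_lin).
by exists (linfun f') => x; rewrite lfunE.
Qed.

Section Adjoint.
Variables (R : realType) (A : cstarAlgType R) (tau : {scalar A}).
Hypothesis tauP : faithful_trace tau.

Lemma tau_adjoint (Phi : 'End(A)) :
  exists Phit : 'End(A), forall x y, tau (Phit x * y) = tau (x * Phi y).
Proof.
have [n [e eP]] := tau_frame_exists tauP.
have [Phit PhitE] : exists Phit : 'End(A), forall x,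
    Phit x = \sum_i tau (x * Phi (e i)) *: star (e i).
  apply: linear_hom => c x y; rewrite scaler_sumr -big_split; apply: eq_bigr => i _.
  by rewrite mulrDl -scalerAl tauD tauZ scalerDl scalerA.
exists Phit => x y; rewrite PhitE mulr_suml linear_sum {2}(eP y) linear_sum mulr_sumr.
rewrite linear_sum; apply: eq_bigr => i _.
by rewrite linearZ /= -scalerAl -scalerAr !tauZ mulrC.
Qed.

Lemma cp_adjoint (Phi Phit : 'End(A)) :
    (forall x y, tau (Phit x * y) = tau (x * Phi y)) ->
  completely_positive tau Phi -> completely_positive tau Phit.
Proof.
move=> adj Phi_cp m a c.
have := Phi_cp m (fun i => star (c i)) (fun i => star (a i)); congr (0 <= _).
rewrite exchange_big !linear_sum; apply: eq_bigr => i _.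
rewrite !linear_sum; apply: eq_bigr => j _ /=.
by rewrite !starK (tauC tauP) mulrA -adj mulrA [LHS](tauC tauP) mulrA.
Qed.

(** The Laplace operator of the CdC of [Phi], before symmetrization; [Phit] is
    the adjoint of [Phi] for the bilinear form [tau (x * y)]. *)
Lemma tau_commutator (Phi Phit : 'End(A)) a b :
    (forall x y, tau (Phit x * y) = tau (x * Phi y)) ->
  tau (Phi (star a * b) - Phi (star a) * b - star a * Phi b + star a * Phi 1 * b) =
  tau (star a * (b * Phit 1 + Phi 1 * b - (Phi b + Phit b))).
Proof.
move=> adj; rewrite mulrBr !mulrDr !(tauB, tauD).
have -> : tau (Phi (star a * b)) = tau (star a * (b * Phit 1)).
  by rewrite -[Phi _]mul1r -adj [LHS](tauC tauP) mulrA.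
have -> : tau (Phi (star a) * b) = tau (star a * Phit b).
  by rewrite [LHS](tauC tauP) -adj [LHS](tauC tauP).
rewrite -mulrA.
ring.
Qed.

End Adjoint.

Section MetricIsCommutator.
Variables (R : realType) (A : cstarAlgType R) (tau : {scalar A}).
Hypothesis tauP : faithful_trace tau.
Variable M : riem_metric A.
Implicit Types (v w : M).

Lemma lact_linear_l w : linear (fun a => lact a w).
Proof.
move=> c a b; have -> : c *: a = c%:A * a by rewrite -scalerAl mul1r.
by rewrite lactDl lactM lact_scalar.
Qed.

Lemma lact_linear_r a : linear (@lact _ _ M a).
Proof.
move=> c v w; rewrite lactDr -!lact_scalar -!lactM.
by rewrite -scalerAr -scalerAl mul1r mulr1.
Qed.

Lemma lact_sum (I : finType) a (F : I -> M) : lact a (\sum_i F i) = \sum_i lact a (F i).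
Proof.
under eq_bigr do rewrite -[F _]scale1r; rewrite (linear_comb _ _ (lact_linear_r a)).
by apply: eq_bigr => i _; rewrite !scale1r.
Qed.

Lemma ract_sum (I : finType) a (F : I -> M) : ract (\sum_i F i) a = \sum_i ract (F i) a.
Proof.
have r0 : ract (0 : M) a = 0.
  by apply: (@addrI _ (ract 0 a)); rewrite -ractDl !addr0.
by apply: (big_morph (fun w => ract w a)) => // v w; rewrite ractDl.
Qed.

(** [xi] is the average [z^-1 sum_i e_i^* (d e_i)] over the tight frame.
    Moving [a] through the Casimir element and applying the Leibniz rule
    leaves the term [z^-1 (sum_i e_i^* e_i) d a = d a]. *)
Lemma derivation_inner : exists xi : M, forall a, dd M a = lact a xi - ract xi a.
Proof.
have [n [e eP]] := tau_frame_exists tauP.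
pose z := frame_index e; have zu := frame_index_unit tauP eP.
pose eta : M := \sum_i lact (star (e i)) (dd M (e i)).
have etaP a : lact a eta = ract eta a + lact z (dd M a).
  rewrite lact_sum ract_sum.
  transitivity (\sum_i lact (a * star (e i)) (dd M (e i))).
    by apply: eq_bigr => i _; rewrite lactM.
  rewrite (frame_casimir tauP eP (B := fun x y => lact x (dd M y))).
  - rewrite -[z]mulr1 /z /frame_index mulr_suml.
    rewrite -[lact (\sum_i _) _](_ : \sum_i lact (star (e i) * e i) (dd M a) = _); last first.
      transitivity (\sum_i 1 *: lact (star (e i) * e i * 1) (dd M a)).
        by apply: eq_bigr => i _; rewrite scale1r mulr1.
      rewrite -(linear_comb _ _ (lact_linear_l (dd M a))).
      by congr (lact _ _); apply: eq_bigr => i _; rewrite scale1r.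
    rewrite -big_split; apply: eq_bigr => i _ /=.
    by rewrite dd_leibniz lactDr lactM lact_ract.
  - by move=> x c u v; rewrite linearP lact_linear_r.
  - by move=> y; exact: lact_linear_l.
exists (lact z^-1 eta) => a.
have zC : a * z^-1 = z^-1 * a by apply/commrV/(frame_index_central tauP eP).
rewrite lact_ract -lactM zC lactM etaP lactDr -lactM mulVr // lact1.
by rewrite addrAC subrr add0r.
Qed.

Lemma ip_ract_l a v w : ip (ract v a) w = star a * ip v w.
Proof. by rewrite -ip_star ip_ract starM ip_star. Qed.

Lemma ipBl u v w : ip (u - v) w = ip u w - ip v w :> A.
Proof. by rewrite ipDl -scaleN1r ipZl rmorphN rmorph1 scaleN1r. Qed.

Lemma ipBr u v w : ip u (v - w) = ip u v - ip u w :> A.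
Proof. by rewrite ipDr -scaleN1r ipZr scaleN1r. Qed.

Lemma metric_cdc_commutator : exists2 Phi : 'End(A), completely_positive tau Phi &
  forall a b, cdc M a b =
    Phi (star a * b) - Phi (star a) * b - star a * Phi b + star a * Phi 1 * b.
Proof.
have [xi xiP] := derivation_inner.
have [Phi PhiE] : exists Phi : 'End(A), forall x, Phi x = ip xi (lact x xi).
  by apply: linear_hom => c x y; rewrite lact_linear_l ipDr ipZr.
exists Phi => [m a c|a b]; last first.
  have Phi1 : Phi 1 = ip xi xi by rewrite PhiE lact1.
  rewrite /cdc !xiP ipBl !ipBr !ip_ract_l !ip_ract !ip_lact -lactM -!PhiE.
  by rewrite -Phi1 opprB !mulrA addrA addrAC.
pose w := \sum_i lact (a i) (ract xi (c i)).
have -> : \sum_i \sum_j star (c i) * Phi (star (a i) * a j) * c j = ip w w.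
  have ip0l u : ip (0 : M) u = 0 by rewrite -(subrr (0 : M)) ipBl subrr.
  have ip0r u : ip u (0 : M) = 0 by rewrite -(subrr (0 : M)) ipBr subrr.
  rewrite {1}/w (big_morph (fun u => ip u w) (fun u v => ipDl u v w) (ip0l w)).
  apply: eq_bigr => i _.
  rewrite /w (big_morph (ip _) (fun u v => ipDr _ u v) (ip0r _)).
  apply: eq_bigr => j _.
  by rewrite PhiE ip_lact ip_ract_l -lactM -lact_ract ip_ract mulrA.
by have [b ->] := ip_ge0 w; exact: tau_sq_ge0.
Qed.

End MetricIsCommutator.

(** The trace of the CdC gives the Laplace operator
    [x |-> x (Phit 1) + (Phi 1) x - Phi x - Phit x].  Reality gives the same
    expression with [Phit 1] and [Phi 1] exchanged; [k] is the half of their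
    sum. *)
Lemma laplace_lindblad (R : realType) (A : cstarAlgType R) (M : riem_metric A)
    (tau : {scalar A}) (Delta : 'End(A)) :
    faithful_trace tau -> real_form (energy_form M tau) ->
    is_laplace tau (energy_form M tau) Delta ->
  exists (k : A) (Psi : 'End(A)),
    [/\ completely_positive tau Psi,
        forall x y, tau (Psi x * y) = tau (x * Psi y),
        Psi 1 = 2 *: k
      & forall x, Delta x = k * x + x * k - Psi x].
Proof.
move=> tauP Ereal [_ EDelta].
have [Phi Phi_cp cdcE] := metric_cdc_commutator tauP M.
have [Phit adj] := tau_adjoint tauP Phi.
have E1 a b : energy_form M tau a b =
    tau (star a * (b * Phit 1 + Phi 1 * b - (Phi b + Phit b))).
  by rewrite /energy_form cdcE (tau_commutator tauP _ _ adj).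
have E2 a b : energy_form M tau a b =
    tau (star a * (Phit 1 * b + b * Phi 1 - (Phi b + Phit b))).
  rewrite -(Ereal b a) E1 starK !mulrBr !mulrDr !tauB !tauD.
  have -> : tau (b * (star a * Phit 1)) = tau (star a * (Phit 1 * b)).
    by rewrite [LHS](tauC tauP) -[in LHS]mulrA.
  have -> : tau (b * (Phi 1 * star a)) = tau (star a * (b * Phi 1)).
    by rewrite [in LHS]mulrA [LHS](tauC tauP).
  have -> : tau (b * Phi (star a)) = tau (star a * Phit b).
    by rewrite -adj [LHS](tauC tauP).
  have -> : tau (b * Phit (star a)) = tau (star a * Phi b).
    by rewrite [LHS](tauC tauP) adj.
  by ring.
pose k := 2^-1 *: (Phit 1 + Phi 1); pose Psi := Phi + Phit.
exists k, Psi; split.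
- apply: (@cp_ext _ _ _ _ (fun x => Phi x + Phit x)) => [x|].
    by rewrite add_lfunE.
  by apply: cp_add => //; exact: cp_adjoint adj _.
- move=> x y; rewrite !add_lfunE mulrDl mulrDr !tauD adj [tau (x * Phit y)](tauC tauP).
  by rewrite adj (tauC tauP y) addrC.
- by rewrite add_lfunE /k scalerA divff ?pnatr_eq0 // scale1r addrC.
move=> x; apply/eqP; rewrite -subr_eq0; apply/eqP/(tau_nondeg tauP) => y.
have D1 := E1 (star y) x; have D2 := E2 (star y) x.
rewrite EDelta /ip_tau starK in D1 D2.
rewrite mulrBr tauB; apply/eqP; rewrite subr_eq0; apply/eqP.
transitivity (2^-1 * (tau (y * Delta x) + tau (y * Delta x))); first by field.
rewrite {1}D1 D2 /k /Psi add_lfunE -scalerAl -scalerAr !(mulrBr, mulrDr, mulrDl).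
rewrite !(tauB, tauD) -!scalerAr !(mulrDr, tauZ, tauD).
by field.
Qed.

(** * Corners and the Schur complement *)

Lemma cp_star_hom (R : realType) (A B : cstarAlgType R) (tau : {scalar B}) (f : A -> B) :
    faithful_trace tau -> (forall x y, f (star x * y) = star (f x) * f y) ->
  completely_positive tau f.
Proof.
move=> tauP fM; have := cp_compress 1 tauP fM.
by apply: cp_ext => x; rewrite star1 mul1r mulr1.
Qed.

Section CornerTrace.
Variables (R : realType) (A : cstarAlgType R) (tau : {scalar A}).
Hypothesis tauP : faithful_trace tau.
Implicit Types P Q : proper_cproj A.

Definition corner_trace P (x : corner P) : R[i]^o := tau (vsval x).
Lemma corner_trace_linear P : linear (@corner_trace P).
Proof. by move=> c x y; rewrite /corner_trace !linearP. Qed.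
HB.instance Definition _ P := GRing.isLinear.Build R[i] (corner P) R[i]^o _
  (@corner_trace P) (@corner_trace_linear P).

Definition tau_corner P : {scalar corner P} := @corner_trace P.

Lemma val_cornerM P (x y : corner P) : vsval (x * y) = vsval x * vsval y.
Proof. by []. Qed.
Lemma val_corner_star P (x : corner P) : vsval (star x) = star (vsval x).
Proof. by []. Qed.
Lemma tau_cornerE P (x : corner P) : tau_corner P x = tau (vsval x).
Proof. by []. Qed.

Lemma corner_eq P (x y : corner P) : vsval x = vsval y -> x = y.
Proof. exact: val_inj. Qed.

Lemma corner_valPr P (x : corner P) : vsval x * cproj P = vsval x.
Proof. by rewrite -cproj_central corner_valP. Qed.

Lemma corner_trace_faithful P : faithful_trace (tau_corner P).
Proof.
split=> [a [b ->]|a b|a ta0]; rewrite ?tau_cornerE.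
- exact: (tau_sq_ge0 tauP).
- exact: (tauC tauP).
- by apply: corner_eq; apply: (tau_sq_eq0 tauP).
Qed.

Lemma corner_quotM P (a b : A) :
  corner_quot P (a * b) = corner_quot P a * corner_quot P b.
Proof.
apply: corner_eq; rewrite val_cornerM !val_corner_quot.
by rewrite [RHS]mulrA -[_ * a * _]mulrA -cproj_central !mulrA cproj_idem.
Qed.

Lemma corner_quot_star P (a : A) : corner_quot P (star a) = star (corner_quot P a).
Proof.
apply: corner_eq; rewrite val_corner_star !val_corner_quot.
by rewrite starM cproj_star cproj_central.
Qed.

Lemma corner_inclK P (x : corner P) : corner_quot P (vsval x) = x.
Proof. by apply: corner_eq; rewrite val_corner_quot corner_valP. Qed.

Lemma corner_quot1 P : corner_quot P 1 = 1.
Proof. by apply: corner_eq; rewrite val_corner_quot mulr1 val_corner1. Qed.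

Lemma corner_quotC P (x : corner (cprojC P)) : corner_quot P (vsval x) = 0.
Proof.
apply: corner_eq; rewrite val_corner_quot -(corner_valP x) mulrA mulrBr mulr1.
by rewrite cproj_idem subrr mul0r.
Qed.

Lemma cornerC_quot P (x : corner P) : corner_quot (cprojC P) (vsval x) = 0.
Proof.
apply: corner_eq; rewrite val_corner_quot -(corner_valP x) mulrA mulrBl mul1r.
by rewrite cproj_idem subrr mul0r.
Qed.

Lemma corner_decomp P (a : A) :
  a = vsval (corner_quot P a) + vsval (corner_quot (cprojC P) a).
Proof. by rewrite !val_corner_quot -mulrDl addrC subrK mul1r. Qed.

Lemma tau_quot_l P (a : A) (x : corner P) :
  tau_corner P (corner_quot P a * x) = tau (a * vsval x).
Proof.
rewrite tau_cornerE val_cornerM val_corner_quot cproj_central -mulrA.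
by rewrite corner_valP.
Qed.

Lemma tau_quot_r P (a : A) (x : corner P) :
  tau_corner P (x * corner_quot P a) = tau (vsval x * a).
Proof. by rewrite tau_cornerE val_cornerM val_corner_quot mulrA corner_valPr. Qed.

Lemma blockE P Q (T : 'End(A)) (x : corner Q) :
  block P Q T x = corner_quot P (T (vsval x)).
Proof. by rewrite /block !comp_lfunE corner_inclE. Qed.

Lemma block_cp P Q (T : 'End(A)) : completely_positive tau T ->
  completely_positive (tau_corner P) (block P Q T).
Proof.
move=> T_cp; pose i (x : corner Q) : A := vsval x.
have i_cp : completely_positive tau i by exact: cp_star_hom.
have quot_cp : completely_positive (tau_corner P) (corner_quot P).
  apply: cp_star_hom (corner_trace_faithful P) _ => x y.
  by rewrite corner_quotM corner_quot_star.
have Ti_cp : completely_positive tau (T \o i) by exact: cp_comp tauP i_cp T_cp.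
have qTi_cp : completely_positive (tau_corner P) (corner_quot P \o (T \o i)).
  exact: cp_comp tauP Ti_cp quot_cp.
by apply: cp_ext qTi_cp => x; rewrite blockE.
Qed.

Lemma block_sym P Q (T : 'End(A)) (x : corner Q) (y : corner P) :
    (forall a b, tau (T a * b) = tau (a * T b)) ->
  tau_corner P (block P Q T x * y) = tau_corner Q (x * block Q P T y).
Proof. by move=> T_sym; rewrite !blockE tau_quot_l tau_quot_r. Qed.

(** For complementary [P] and [Q] the first two terms vanish, which is why the
    off-diagonal blocks of a Laplace operator are completely positive up to
    sign. *)
Lemma block_commutator P Q (Delta Psi : 'End(A)) k (x : corner Q) :
    (forall a, Delta a = k * a + a * k - Psi a) ->
  block P Q Delta x = corner_quot P k * corner_quot P (vsval x) +
    corner_quot P (vsval x) * corner_quot P k - block P Q Psi x.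
Proof. by move=> DE; rewrite !blockE DE -!corner_quotM -linearD -linearB. Qed.

End CornerTrace.

Lemma quotient_laplaceE (R : realType) (A : cstarAlgType R) (P : proper_cproj A)
    (Delta : 'End(A)) (b : corner P) :
  quotient_laplace P Delta b = block P P Delta b -
    block P (cprojC P) Delta
      ((block (cprojC P) (cprojC P) Delta)^-1%VF (block (cprojC P) P Delta b)).
Proof. by rewrite [LHS]add_lfunE opp_lfunE -comp_lfunE -comp_lfunE. Qed.

Lemma energy_eq0 (R : realType) (A : cstarAlgType R) (tau : {scalar A})
    (M : riem_metric A) (a : A) : faithful_trace tau -> 
  energy_form M tau a a = 0 -> cdc M a a = 0.
Proof.
move=> tauP; rewrite /energy_form /cdc.
have [b ->] := ip_ge0 (dd M a) => /(tau_sq_eq0 tauP) ->.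
by rewrite mulr0.
Qed.

Theorem theorem12p2 (R : realType) (A : cstarAlgType R) (M : riem_metric A)
    (tau : {scalar A}) (Delta : 'End(A)) (p : proper_cproj A) :
  metrically_connected M ->
  faithful_trace tau ->
  real_form (energy_form M tau) ->
  is_laplace tau (energy_form M tau) Delta ->
  exists (N : riem_metric (corner p)) (tauB : {scalar corner p}),
    [/\ metrically_connected N,
        faithful_trace tauB
      & forall b b' : corner p,
          quotient_form tau Delta b b' = energy_form N tauB b b'].
Proof.
move=> M_conn tauP E_real Delta_laplace.
have [k [Psi [Psi_cp Psi_sym Psi1 DeltaE]]] := laplace_lindblad tauP E_real Delta_laplace.
have [Delta_ge0 EDelta] := Delta_laplace.
pose q := cprojC p.
pose trB := tau_corner tau p; pose trC := tau_corner tau q.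
have tauBP : faithful_trace trB := corner_trace_faithful tauP p.
have tauCP : faithful_trace trC := corner_trace_faithful tauP q.
pose S := block q q Delta; pose J := block q p Delta.
pose X (P Q : proper_cproj A) := block P Q Psi.
pose kB := corner_quot p k; pose kC := corner_quot q k.
have SE x : S x = kC * x + x * kC - X q q x.
  by rewrite /S (block_commutator _ _ DeltaE) corner_inclK.
have JE x : J x = - X q p x.
  rewrite /J (block_commutator _ _ DeltaE) cornerC_quot.
  by rewrite mulr0 mul0r addr0 sub0r.
have JsE x : block p q Delta x = - X p q x.
  rewrite (block_commutator _ _ DeltaE) corner_quotC.
  by rewrite mulr0 mul0r addr0 sub0r.
have RE x : block p p Delta x = kB * x + x * kB - X p p x.
  by rewrite (block_commutator _ _ DeltaE) corner_inclK.
have S_form x : trC (star x * S x) = ip_tau tau (vsval x) (Delta (vsval x)).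
  by rewrite /S blockE tau_quot_r.
have S_ge0 x : 0 <= trC (star x * S x) by rewrite S_form.
(* A multiple of 1 in the corner of q is killed by p, hence is 0. *)
have S_inj x : trC (star x * S x) = 0 -> x = 0.
  rewrite S_form -EDelta => /(energy_eq0 tauP)/M_conn[c xc].
  have := corner_quotC x; rewrite xc linearZ /= corner_quot1 => /eqP.
  rewrite scaler_eq0 oner_eq0 orbF => /eqP c0.
  by apply: corner_eq; rewrite xc c0 scale0r linear0.
have kC_pos : tau_pos trC kC.
  move=> d; have := cp_tau_pos1 Psi_cp (vsval d).
  rewrite Psi1 -scalerAr -scalerAl tauZ pmulr_rge0 //; congr (0 <= _).
  rewrite /trC tau_cornerE !val_cornerM /kC val_corner_quot mulrA.
  by rewrite (corner_valPr (star d)).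
pose Z := S^-1%VF.
have Z_cp : completely_positive trC Z.
  exact: (inverse_cp tauCP kC_pos (block_cp tauP Psi_cp) SE S_ge0 S_inj).
have ZS x : Z (S x) = x by case: (definite_endK S_inj x).
have SZ x : S (Z x) = x by case: (definite_endK S_inj x).
pose PsiB : 'End(corner p) := (X p p + (X p q \o (Z \o X q p)))%VF.
have PsiBE x : PsiB x = X p p x + X p q (Z (X q p x)).
  by rewrite add_lfunE !comp_lfunE.
have PsiB_cp : completely_positive trB PsiB.
  apply: (@cp_ext _ _ _ _ (fun x => X p p x + (X p q \o (Z \o X q p)) x)) => [x|].
    by rewrite PsiBE.
  apply: cp_add; first exact: block_cp.
  apply: (cp_comp tauCP _ (block_cp tauP Psi_cp)).
  exact: (cp_comp tauCP (block_cp tauP Psi_cp) Z_cp).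
have lapE b : quotient_laplace p Delta b = kB * b + b * kB - PsiB b.
  rewrite quotient_laplaceE -/q -/S -/J -/Z RE JE JsE PsiBE.
  by rewrite (linearN Z) (linearN (X p q)) opprK opprD addrA.
have X1 P : X P p 1 + X P q 1 = 2 *: corner_quot P k.
  rewrite /X !blockE !val_corner1 -!linearD /= addrC subrK Psi1.
  by rewrite linearZ.
(* S 1 = Psi_qp 1, as Psi 1 = 2 k; thus S^-1 Psi_qp fixes the unit. *)
have PsiB1 : PsiB 1 = 2 *: kB.
  have Z1 : Z (X q p 1) = 1.
    rewrite -[RHS]ZS; congr (Z _); rewrite SE mulr1 mul1r -/kC.
    by rewrite -mulr2n -scaler_nat -X1 addrK.
  by rewrite PsiBE Z1 X1.
have Delta_sym a b : tau (Delta a * b) = tau (a * Delta b).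
  rewrite !DeltaE !(mulrBl, mulrBr, mulrDl, mulrDr) !(tauB, tauD) Psi_sym.
  rewrite [X in X - _ = _]addrC -!mulrA; congr (_ + _ - _).
  by rewrite [LHS](tauC tauP) -mulrA.
have Z_sym x y : trC (Z x * y) = trC (x * Z y).
  by rewrite -{1}[y]SZ -{2}[x]SZ (block_sym _ _ Delta_sym).
have PsiB_sym x y : trB (PsiB x * y) = trB (x * PsiB y).
  rewrite !PsiBE mulrDl mulrDr !tauD (block_sym _ _ Psi_sym); congr (_ + _).
  by rewrite (block_sym _ _ Psi_sym) Z_sym (block_sym _ _ Psi_sym).
have [n [e eP]] := tau_frame_exists tauBP.
pose Phi : 'End(corner p) := 2^-1 *: PsiB.
have PhiE x : Phi x = 2^-1 *: PsiB x by rewrite scale_lfunE.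
have Phi_cp : completely_positive trB Phi.
  apply: (@cp_ext _ _ _ _ (fun x => 2^-1 *: PsiB x)) => [x|]; first by rewrite PhiE.
  by apply: cp_scale; rewrite ?invr_ge0.
have Phi_sym x y : trB (Phi x * y) = trB (x * Phi y).
  by rewrite !PhiE -scalerAl -scalerAr !tauZ PsiB_sym.
have QE b b' : quotient_form tau Delta b b' = 
    energy_form (cp_metric tauBP eP Phi_cp) trB b b'.
  rewrite /energy_form cp_metric_cdc (tau_commutator tauBP _ _ Phi_sym).
  rewrite !PhiE PsiB1 scalerA mulVf ?pnatr_eq0 // scale1r -scalerDl.
  rewrite (_ : 2^-1 + 2^-1 = 1) ?scale1r; last by field.
  by rewrite /quotient_form lapE [kB * _ + _]addrC.
exists (cp_metric tauBP eP Phi_cp), trB; split=> //.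
move=> b /(congr1 trB); rewrite -/(energy_form _ _ _ _) -QE linear0 => Eb0.
(* h is the harmonic extension of b, for which the energies agree. *)
pose c := Z (J b); pose h := vsval b - vsval c.
have Dh : Delta h = vsval (quotient_laplace p Delta b).
  have hq : corner_quot q (Delta h) = 0.
    by rewrite /h !linearB /= -!blockE -/S -/J /c SZ subrr.
  rewrite [LHS](corner_decomp p) hq linear0 addr0 /h !linearB /= -!blockE.
  by rewrite quotient_laplaceE.
have /(energy_eq0 tauP)/M_conn[r hr] : energy_form M tau h h = 0.
  rewrite EDelta /ip_tau Dh /h starD starN mulrBl tauB.
  have -> : tau (star (vsval c) * vsval (quotient_laplace p Delta b)) = 0.
    by rewrite -(tau_quot_r tau _ (star c)) cornerC_quot mulr0 linear0.
  by rewrite subr0; exact: Eb0.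
exists r; apply: corner_eq.
have -> : vsval (r%:A : corner p) = r *: cproj p by rewrite -val_corner1.
have := congr1 (fun a => cproj p * a) hr; rewrite -scalerAr mulr1 => <-.
have pc0 : cproj p * vsval c = 0 by rewrite -val_corner_quot corner_quotC.
by rewrite /h mulrBr corner_valP pc0 subr0.
Qed.
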